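(* Let $\mu$ be a unimodular probability measure on $\mathcal G_\ast$ of bounded degree, i.e. there is $D\in\mathbb N$ such that for $\mu$-a.e. $[G,o]$ one has $\deg_G(v)\le D$ for all $v\in V(G)$, and let $(f,h,\psi)$ be an admissible potential triple for $\mu$ (as defined in the context). Suppose moreover that for $\mu$-a.e. $[G,o]$ and every family $(b_v)_{v\sim o}\subset H$, the map $a\mapsto f([G,o],a)+\sum_{v\sim o}h([G,o,v],a,b_v)$ is convex. Let $x^\ast\in\mathcal K$ and consider the statements: (i) $x^\ast$ is a minimizer of $\Phi$ over $\mathcal K$. (ii) $\langle F(x^\ast),z-x^\ast\rangle_{\mathcal H}\ge0$ for all $z\in\mathcal K$. (iii) $x^\ast$ is a quenched Nash equilibrium. Then (i) implies (ii), and (ii) is equivalent to (iii). If, in addition, $\Phi$ is convex on $\mathcal K$, then (ii) also implies (i).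
   Context: Graphs. All graphs $G=(V,E)$ are simple (undirected, no loops or multiple edges), locally finite, with finite or countably infinite vertex set $V=V(G)$; $u\sim v$ means $\{u,v\}\in E$. A rooted graph $(G,o)$ is a graph with a distinguished vertex $o$; rooted isomorphisms are graph isomorphisms mapping root to root, and $[G,o]$ is the isomorphism class. $B_r(G,o)$ is the rooted subgraph induced by the vertices at graph distance at most $r$ from $o$. $\mathcal G_\ast$ is the set of isomorphism classes of countable, connected, rooted graphs with metric $d_\ast([G,o],[G',o'])=\inf_{r\in\mathbb N_0}\{2^{-r}:B_r(G,o)\cong B_r(G',o')\}$. $\mathcal G_{\ast\ast}$ is the analogous space of isomorphism classes $[G,o_1,o_2]$ of countable, connected, doubly rooted graphs (isomorphisms preserve both roots in order), with the analogous metric $d_{\ast\ast}$. Both carry Borel $\sigma$-fields. A probability measure $\mu$ on $\mathcal G_\ast$ is unimodular if for every measurable $T:\mathcal G_{\ast\ast}\to[0,\infty]$, $\int\sum_{v\in V(G)}T([G,o,v])\,\mu(d[G,o])=\int\sum_{v\in V(G)}T([G,v,o])\,\mu(d[G,o])$. Spaces. $H$ is a separable real Hilbert space and $K\subset H$ is nonempty, closed and convex. $\mathcal H=L^2(\mu,H)$ is the Hilbert space of measurable $x:\mathcal G_\ast\to H$ with $\int\|x([G,o])\|_H^2\,\mu(d[G,o])<\infty$, with inner product $\langle x,y\rangle_{\mathcal H}=\int\langle x([G,o]),y([G,o])\rangle_H\,\mu(d[G,o])$, and $\mathcal K=\{x\in\mathcal H: x([G,o])\in K\text{ for }\mu\text{-a.e.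 }[G,o]\}$. For $x:\mathcal G_\ast\to H$ and a countable connected graph $G$, write $x^G_v=x([G,v])$, $v\in V(G)$, and $x^G=(x^G_v)_{v\in V(G)}$. Admissible potential triple. Measurable functions $f:\mathcal G_\ast\times H\to\mathbb R$ (private cost), $h:\mathcal G_{\ast\ast}\times H\times H\to\mathbb R$ (interaction cost) and $\psi:\mathcal G_{\ast\ast}\times H\times H\to\mathbb R$ form an admissible potential triple for $\mu$ if the following hold ($\nabla$ is the Gâteaux gradient; $\nabla_1,\nabla_2$ are partial gradients in the first and second $H$-argument). (i) For $\mu$-a.e. $[G,o]$, $a\mapsto f([G,o],a)$ is Gâteaux differentiable on $H$. (ii) For $\mu$-a.e. $[G,o]$ and every $v\sim o$: $a\mapsto h([G,o,v],a,b)$ is Gâteaux differentiable on $H$ for every $b\in H$; $(a,b)\mapsto\psi([G,o,v],a,b)$ is Gâteaux differentiable on $H\times H$; and for all $a,b\in H$, $\nabla_1\psi([G,o,v],a,b)=\nabla_1h([G,o,v],a,b)$ and $\nabla_2\psi([G,o,v],a,b)=\nabla_1h([G,v,o],b,a)$. (iii) There are constants $L_f,L_h\ge0$ such that for $\mu$-a.e. $[G,o]$, every $v\sim o$ and all $a,a',b,b'\in H$: $\|\nabla f([G,o],a)-\nabla f([G,o],a')\|_H\le L_f\|a-a'\|_H$ and $\|\nabla_1h([G,o,v],a,b)-\nabla_1h([G,o,v],a',b')\|_H\le L_h(\|a-a'\|_H+\|b-b'\|_H)$. (iv) There is $a_\ast\in H$ such that the functions $|f([G,o],a_\ast)|$,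 $\|\nabla f([G,o],a_\ast)\|_H^2$, $\sum_{v\sim o}|\psi([G,o,v],a_\ast,a_\ast)|$ and $\sum_{v\sim o}\|\nabla_1h([G,o,v],a_\ast,a_\ast)\|_H^2$ of $[G,o]$ all have finite $\mu$-integral. Potential functional. $\Phi(x)=\int_{\mathcal G_\ast}\big[f([G,o],x([G,o]))+\frac12\sum_{v\sim o}\psi([G,o,v],x([G,o]),x([G,v]))\big]\mu(d[G,o])$ for $x\in\mathcal H$; it is finite on $\mathcal H$ under these hypotheses. First-order operator. $F:\mathcal H\to\mathcal H$, $F(x)([G,o])=\nabla f([G,o],x([G,o]))+\sum_{v\sim o}\nabla_1h([G,o,v],x([G,o]),x([G,v]))$. Game. The cost of player $v\in V(G)$ under an action profile $x^G\in K^{V(G)}$ is $J^G_v(x^G)=f([G,v],x^G_v)+\sum_{u\sim v}h([G,v,u],x^G_v,x^G_u)$. An element $x\in\mathcal K$ is a quenched Nash equilibrium if for $\mu$-a.e. $[G,o]$, $J^G_o(x^G)\le J^G_o(a,x^G_{-o})$ for all $a\in K$, where $(a,x^G_{-o})$ is $x^G$ with the root action $x^G_o$ replaced by $a$. *)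

(* Defs.v *)
From HB Require Import structures.
From mathcomp Require Import all_boot all_order all_algebra finmap sesquilinear.
From mathcomp Require Import generic_quotient.
From mathcomp Require Import all_classical all_reals all_analysis.
From mathcomp Require Import measurable_realfun.

Set Implicit Arguments.
Unset Strict Implicit.
Unset Printing Implicit Defensive.

Import Order.TTheory GRing.Theory Num.Theory numFieldNormedType.Exports.

Local Open Scope classical_set_scope.
Local Open Scope quotient_scope.
Local Open Scope ring_scope.

(* A countable connected, simple, locally finite graph.  Vertex sets are
   subsets of nat: every finite or countably infinite graph is isomorphic to
   such a graph, and graphs only matter up to isomorphism. *)
Record cgraph := CGraph {
  vset : pred nat;
  adj : rel {n | vset n};
  adj_sym : symmetric adj;
  adj_irr : irreflexive adj;
  adj_lfin : forall v, finite_set [set u | adj v u];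
  adj_conn : forall u v, exists2 p, path adj u p & last u p = v
}.

Definition vertex (G : cgraph) := {n | vset G n}.
Coercion vertex : cgraph >-> Sortclass.

Definition nbr (G : cgraph) (v : G) : set G := [set u | adj v u].

Definition deg (G : cgraph) (v : G) : nat := #|` fset_set (nbr v)|%fset.

Record rooted (k : nat) := Rooted {
  rgraph : cgraph;
  roots : k.-tuple rgraph
}.

Section isomorphism.
Variable k : nat.
Implicit Types A B C : rooted k.

(* phi restricts to an isomorphism between the subgraphs induced by X and Y,
   and maps roots to roots in order. *)
Definition induced_iso A B (X : set (rgraph A)) (Y : set (rgraph B)) : Prop :=
  exists phi : rgraph A -> rgraph B,
    [/\ set_bij X Y phi,
        {in X &, forall u v, adj (phi u) (phi v) = adj u v} &
        map phi (roots A) = roots B].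

Definition riso A B : bool := `[< @induced_iso A B setT setT >].

Lemma riso_refl : reflexive riso.
Proof.
move=> A; apply/asboolP; exists id; split=> //; last by rewrite map_id.
by split=> // [u _ //|u v _ _ //|u _]; exists u.
Qed.

Lemma riso_symm A B : riso A B -> riso B A.
Proof.
move=> /asboolP[phi [bphi ephi rphi]]; apply/asboolP.
have [psi phiK psiK] : bijective phi by rewrite -setTT_bijective.
exists psi; split.
- by rewrite setTT_bijective; exists phi.
- by move=> u v _ _; rewrite -[in RHS](psiK u) -[in RHS](psiK v) ephi ?in_setT.
- by rewrite -rphi -map_comp (eq_map phiK) map_id.
Qed.

Lemma riso_sym : symmetric riso.
Proof. by move=> A B; apply/idP/idP => /riso_symm. Qed.

Lemma riso_trans : transitive riso.
Proof.
move=> B A C /asboolP[phi [bphi ephi rphi]] /asboolP[psi [bpsi epsi rpsi]].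
apply/asboolP; exists (psi \o phi); split.
- by rewrite setTT_bijective; apply: bij_comp; rewrite -setTT_bijective.
- by move=> u v _ _ /=; rewrite epsi ?in_setT// ephi ?in_setT.
- by rewrite map_comp rphi.
Qed.

HB.instance Definition _ := gen_eqMixin (rooted k).
HB.instance Definition _ := gen_choiceMixin (rooted k).

Canonical riso_equiv := EquivRel riso riso_refl riso_sym riso_trans.

(* [isoclass 1] is the set G_* and [isoclass 2] is the set G_**. *)
Definition isoclass := {eq_quot riso}.

HB.instance Definition _ := Choice.on isoclass.
HB.instance Definition _ := EqQuotient.on isoclass.

End isomorphism.

Section point.

Let V0 := {n : nat | pred1 0%N n}.

Let V0_eq (u v : V0) : u = v.
Proof. by apply/val_inj; case: u v => [u /= /eqP ->] [v /= /eqP ->]. Qed.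

Let adj0 (u v : V0) := false.

Definition point_graph : cgraph.
Proof.
apply: (@CGraph (pred1 0%N) adj0) => //.
- by move=> v; apply: sub_finite_set (finite_set0 _).
- by move=> u v; exists [::] => //=; exact: V0_eq.
Defined.

Definition point_rooted k : rooted k :=
  @Rooted k point_graph [tuple of nseq k (exist _ 0%N (eqxx 0%N))].

HB.instance Definition _ k :=
  isPointed.Build (isoclass k) (\pi_(isoclass k) (point_rooted k)).

End point.

(* [G, v] and [G, u, v]. *)
Definition cls1 (G : cgraph) (v : G) : isoclass 1 :=
  \pi_(isoclass 1) (@Rooted 1 G [tuple v]).
Definition cls2 (G : cgraph) (u v : G) : isoclass 2 :=
  \pi_(isoclass 2) (@Rooted 2 G [tuple u; v]).

Lemma cls_iso (G G' : cgraph) (phi : G -> G') : bijective phi ->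
    (forall u v, adj (phi u) (phi v) = adj u v) ->
  (forall v, cls1 (phi v) = cls1 v) /\
  (forall u v, cls2 (phi u) (phi v) = cls2 u v).
Proof.
move=> bphi ephi; split=> [v|u v]; apply/esym/eqmodP/asboolP; exists phi.
  by split=> //=; rewrite setTT_bijective.
by split=> //=; rewrite setTT_bijective.
Qed.

(* A representative (G, o) of a class.  It is only used in expressions that
   are invariant under rooted isomorphisms. *)
Definition graph_of (g : isoclass 1) : cgraph := rgraph (repr g).
Definition root_of (g : isoclass 1) : graph_of g := thead (roots (repr g)).

Lemma cls1_root_of_of (g : isoclass 1) : cls1 (root_of g) = g.
Proof.
rewrite /cls1 /root_of /graph_of -[RHS]reprK; case: (repr g) => G r /=.
by congr (\pi_(isoclass 1) (Rooted _)); apply/val_inj; case: r => -[|a []].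
Qed.

(* Vertices at graph distance at most r from one of the roots. *)
Definition rball k (r : nat) (A : rooted k) : set (rgraph A) :=
  [set v | exists o, o \in roots A /\
     exists p, [/\ path (@adj _) o p, last o p = v & (size p <= r)%N]].
Arguments rball {k} r A.

Section borel.
Variable R : realType.

(* The infimum is taken in the extended reals: for k = 2 it is over the empty
   set, with value +oo, when the balls of radius 0 are not isomorphic. *)
Definition local_dist k (g g' : isoclass k) : \bar R :=
  ereal_inf [set (2 ^- r)%:E |
    r in [set r | induced_iso (rball r (repr g)) (rball r (repr g'))]].

Definition local_open k : set (set (isoclass k)) :=
  [set U | forall g, U g ->
    exists2 e : R, 0 < e & forall g', (local_dist g g' < e%:E)%E -> U g'].

Definition Gspace k : measurableType _ := g_sigma_algebraType (@local_open k).

Definition borel (T : ptopologicalType) : measurableType _ :=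
  g_sigma_algebraType (@open T).

Definition unimodular (mu : probability (Gspace 1) R) : Prop :=
  forall T : Gspace 2 -> \bar R,
    measurable_fun setT T -> (forall g, 0 <= T g)%E ->
    (\int[mu]_g (\esum_(v in [set: graph_of g]) T (cls2 (root_of g) v)) =
     \int[mu]_g (\esum_(v in [set: graph_of g]) T (cls2 v (root_of g))))%E.

Definition bounded_degree (mu : probability (Gspace 1) R) : Prop :=
  exists D : nat,
    {ae mu, forall g, forall v : graph_of g, (deg v <= D)%N}.

End borel.

Definition separable (T : topologicalType) : Prop :=
  exists2 S : set T, countable S & dense S.

Section gateaux.
Variables (R : realType) (V : normedModType R) (ip : V -> V -> R).

Definition is_gradient (f : V -> R) (a p : V) : Prop :=
  forall v, is_derive a v f (ip p v).

Definition gateaux_differentiable (f : V -> R) : Prop :=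
  forall a, exists p, is_gradient f a p.

(* Unspecified if f is not Gateaux differentiable at a. *)
Definition gradient (f : V -> R) (a : V) : V :=
  get [set p | is_gradient f a p].

End gateaux.

Section game.
Variables (R : realType) (H : completeNormedModType R).
Variable dot : {dot H for idfun}.
Variable mu : probability (Gspace R 1) R.
Implicit Types (f : isoclass 1 -> H -> R) (h psi : isoclass 2 -> H -> H -> R).
Implicit Types (x y : isoclass 1 -> H) (K : set H).

Local Notation grad := (gradient dot).

Definition dot_prod (p q : H * H) : R := dot p.1 q.1 + dot p.2 q.2.

Definition L2 : set (isoclass 1 -> H) :=
  [set x | measurable_fun setT (x : Gspace R 1 -> borel H) /\
           (\int[mu]_g (`|x g| ^+ 2)%:E < +oo)%E].

Definition L2_dot x y : R := \int[mu]_g dot (x g) (y g).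

Definition L2_in K : set (isoclass 1 -> H) :=
  [set x | L2 x /\ {ae mu, forall g, K (x g)}].

Definition grad1 h (g : isoclass 2) (a b : H) : H := grad (h g ^~ b) a.
Definition grad2 h (g : isoclass 2) (a b : H) : H := grad (h g a) b.

Record admissible f h psi : Prop := Admissible {
  adm_measurable_f : measurable_fun setT
    (fun p : Gspace R 1 * borel H => f p.1 p.2);
  adm_measurable_h : measurable_fun setT
    (fun p : Gspace R 2 * borel H * borel H => h p.1.1 p.1.2 p.2);
  adm_measurable_psi : measurable_fun setT
    (fun p : Gspace R 2 * borel H * borel H => psi p.1.1 p.1.2 p.2);
  adm_diff_f : {ae mu, forall g, gateaux_differentiable dot (f g)};
  adm_diff_h : {ae mu, forall g, forall v, nbr (root_of g) v ->
    let ov := cls2 (root_of g) v in let vo := cls2 v (root_of g) in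
    [/\ forall b, gateaux_differentiable dot (h ov ^~ b),
        gateaux_differentiable dot_prod (fun p => psi ov p.1 p.2),
        forall a b, grad1 psi ov a b = grad1 h ov a b &
        forall a b, grad2 psi ov a b = grad1 h vo b a]};
  adm_lipschitz : exists Lf Lh : R, [/\ 0 <= Lf, 0 <= Lh &
    {ae mu, forall g,
      (forall a a', `|grad (f g) a - grad (f g) a'| <= Lf * `|a - a'|) /\
      (forall v, nbr (root_of g) v -> forall a a' b b',
         `|grad1 h (cls2 (root_of g) v) a b - grad1 h (cls2 (root_of g) v) a' b'|
         <= Lh * (`|a - a'| + `|b - b'|))}];
  adm_integrable : exists a : H,
    [/\ (\int[mu]_g (`|f g a|)%:E < +oo)%E,
        (\int[mu]_g (`|grad (f g) a| ^+ 2)%:E < +oo)%E,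
        (\int[mu]_g (\sum_(v \in nbr (root_of g))
            `|psi (cls2 (root_of g) v) a a|)%:E < +oo)%E &
        (\int[mu]_g (\sum_(v \in nbr (root_of g))
            `|grad1 h (cls2 (root_of g) v) a a| ^+ 2)%:E < +oo)%E]
}.

Definition Phi f psi x : R :=
  \int[mu]_g (f g (x g) + 2^-1 * \sum_(v \in nbr (root_of g))
    psi (cls2 (root_of g) v) (x g) (x (cls1 v))).

Definition first_order f h x (g : isoclass 1) : H :=
  grad (f g) (x g) + \sum_(v \in nbr (root_of g))
    grad1 h (cls2 (root_of g) v) (x g) (x (cls1 v)).

Definition cost f h (G : cgraph) (v : G) (xG : G -> H) : R :=
  f (cls1 v) (xG v) + \sum_(u \in nbr v) h (cls2 v u) (xG v) (xG u).

Definition profile x (G : cgraph) (v : G) : H := x (cls1 v).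

Definition quenched_nash f h K x : Prop :=
  {ae mu, forall g, forall a, K a ->
    let o := root_of g in let xG := @profile x (graph_of g) in
    cost f h o xG <= cost f h o [eta xG with o |-> a]}.

End game.

(* Main.v *)
From Pilot Require Import Defs.
From HB Require Import structures.
From mathcomp Require Import all_boot all_order all_algebra finmap sesquilinear.
From mathcomp Require Import generic_quotient.
From mathcomp Require Import all_classical all_reals all_analysis.
From mathcomp Require Import measurable_realfun.
From mathcomp Require Import lra.

Set Implicit Arguments.
Unset Strict Implicit.
Unset Printing Implicit Defensive.

Import Order.TTheory GRing.Theory Num.Theory numFieldNormedType.Exports.

Local Open Scope classical_set_scope.
Local Open Scope quotient_scope.
Local Open Scope ring_scope.

(* Differentiating the potential along a direction [y] produces, for every edge
   [o ~ v], the two terms [<grad_1 h(o,v), y_o>] and [<grad_1 h(v,o), y_v>] with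
   weight 1/2.  The mass transport principle moves the second one back to the
   root, so that the derivative of the potential is exactly [<F(x), y>]; the
   Lipschitz gradients give a quadratic remainder whose coefficient is
   integrable because degrees are bounded.  This gives (i) => (ii), and
   (ii) => (i) under convexity.  For (ii) => (iii) the variational inequality is
   tested against deviations to a point [k] of a countable dense subset of [K] on
   the set where [<F(x), k - x> < 0], which shows that this set is null; the
   pointwise first order condition is then equivalent to optimality of the root
   action because the root cost is convex.

   Measurability of edge sums comes from the local topology: for an open set [B]
   of doubly rooted graphs, the number of neighbours [v] of the root [o] with
   [[G, o, v]] in [B] is lower semicontinuous.  Gradients are only defined almost
   everywhere, so they enter integrals through everywhere measurable upper limits
   of difference quotients. *)

Local Notation roots := Pilot.Defs.roots.
Local Notation rgraph := Pilot.Defs.rgraph.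

(** * Isomorphisms of balls *)

Arguments rball {k} r A.

Section balls.

Definition ball_iso k (s : nat) (A B : rooted k) : Prop :=
  induced_iso (rball s A) (rball s B).

Lemma ball_iso_trans k s (A B C : rooted k) :
  ball_iso s A B -> ball_iso s B C -> ball_iso s A C.
Proof.
move=> [phi [bphi ephi rphi]] [psi [bpsi epsi rpsi]].
exists (psi \o phi); split.
- exact: set_bij_comp bphi bpsi.
- have [fphi _ _] := bphi.
  by move=> u v uA vA /=; rewrite epsi ?ephi//; apply/mem_set/fphi/set_mem.
- by rewrite map_comp rphi.
Qed.

Variables (G G' : cgraph) (X : set G) (Y : set G') (phi : G -> G').
Hypothesis bphi : set_bij X Y phi.
Hypothesis ephi : {in X &, forall u v, adj (phi u) (phi v) = adj u v}.

Let rA l (w : l.-tuple G) : rooted l := @Rooted l G w.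
Let rB l (w : l.-tuple G) : rooted l := @Rooted l G' [tuple of map phi w].

(** Every prefix of a path of length at most [s] from a root ends in the ball, hence in [X], where
    [phi] preserves adjacency; so the path is mapped edge by edge. *)
Lemma rball_image l (w : l.-tuple G) s : rball s (rA w) `<=` X ->
  forall u, rball s (rA w) u -> rball s (rB w) (phi u).
Proof.
move=> sX u [ o [ow [p [pp <- sp]]]].
exists (phi o); split; first exact: map_f.
exists (map phi p); split; last by rewrite size_map.
- have oX : forall q, path (@adj _) o q -> (size q <= s)%N -> X (last o q).
    by move=> q pq sq; apply: sX; exists o; split=> //; exists q.
  elim/last_ind: p pp sp => [//|p v IH].
  rewrite rcons_path map_rcons rcons_path size_rcons => /andP[pp av] sp.
  have sp' : (size p <= s)%N by exact: ltnW.
  apply/andP; split; first exact: IH.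
  rewrite last_map ephi ?inE//; first exact: oX.
  have := oX (rcons p v); rewrite rcons_path pp av size_rcons last_rcons.
  by apply.
- by rewrite last_map.
Qed.

(** Paths are lifted one vertex at a time: the next vertex lies in [Y], so it has a preimage in [X],
    and [phi] reflects adjacency there. *)
Lemma rball_lift l (w : l.-tuple G) s : rball s (rA w) `<=` X ->
  rball s (rB w) `<=` Y ->
  forall v, rball s (rB w) v -> exists2 u, rball s (rA w) u & phi u = v.
Proof.
move=> sX sY v [_ [/mapP[ o ow ->] [p [pp <- sp]]]].
suff: exists2 q, path (@adj _) o q /\ (size q = size p)%N &
      phi (last o q) = last (phi o) p.
  move=> [q [pq sq] lq]; exists (last o q) => //.
  by exists o; split=> //; exists q; split=> //; rewrite sq.
elim/last_ind: p pp sp => [_ _|p v' IH].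
  by exists [::].
rewrite rcons_path size_rcons => /andP[pp av] sp.
have [q [pq sq] lq] := IH pp (ltnW sp).
have Yv' : Y v'.
  apply: sY; exists (phi o); split; first exact: map_f.
  by exists (rcons p v'); rewrite rcons_path pp av last_rcons size_rcons.
have [_ _ sur] := bphi.
have [u Xu uv'] := sur _ Yv'.
have Xq : X (last o q).
  by apply: sX; exists o; split=> //; exists q; split => //; rewrite sq ltnW.
have aqu : adj (last o q) u by rewrite -ephi ?inE// lq uv'.
exists (rcons q u); last by rewrite !last_rcons.
by rewrite rcons_path pq aqu !size_rcons sq.
Qed.

(** The tuple [w] is arbitrary, so an isomorphism between balls can be reused for balls around other
    roots that lie inside them. *)
Lemma induced_iso_restrict l (w : l.-tuple G) s : rball s (rA w) `<=` X ->
  rball s (rB w) `<=` Y -> ball_iso s (rA w) (rB w).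
Proof.
move=> sX sY; exists phi; split => //.
- split.
  + exact: rball_image.
  + have [_ iphi _] := bphi.
    by move=> u v /set_mem/sX/mem_set uX /set_mem/sX/mem_set vX; exact: iphi.
  + by move=> v /(rball_lift sX sY)[u ru <-]; exists u.
- by move=> u v /set_mem/sX/mem_set uX /set_mem/sX/mem_set vX; exact: ephi.
Qed.

End balls.

Lemma riso_ball k s (A B : rooted k) : riso A B -> ball_iso s A B.
Proof.
move=> /asboolP[phi [bphi ephi rphi]].
case: A B phi bphi ephi rphi => [G w] [G' w'] /= phi bphi ephi rphi.
have := @induced_iso_restrict G G' setT setT phi bphi ephi k w s (@subsetT _ _) (@subsetT _ _).
by congr (ball_iso s _ (@Rooted _ _ _)); exact/val_inj.
Qed.

Lemma repr_riso k (A : rooted k) : riso (repr (\pi_(isoclass k) A)) A.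
Proof. by apply/eqmodP; rewrite reprK. Qed.

Lemma ball_iso_repr k s (A B : rooted k) : ball_iso s A B ->
  ball_iso s (repr (\pi_(isoclass k) A)) (repr (\pi_(isoclass k) B)).
Proof.
move=> AB; apply: ball_iso_trans (riso_ball s (repr_riso A)) _.
by apply: ball_iso_trans AB _; apply/riso_ball/riso_symm/repr_riso.
Qed.

Lemma rball_roots k r l (G : cgraph) (w : k.-tuple G) (w' : l.-tuple G) :
  {subset w <= w'} -> rball r (@Rooted k G w) `<=` rball r (@Rooted l G w').
Proof. by move=> ww' v [ o [/ww' ow' op]]; exists o. Qed.

(** A distance below [2 ^- r] is witnessed by some radius beyond [r], not by [r] itself. Quantifying
    over all [s >= r] avoids restricting isomorphisms to smaller balls. *)
Lemma local_openP (R : realType) k (U : set (isoclass k)) :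
  local_open R U <-> forall g, U g -> exists r, forall g' s, (r <= s)%N ->
    ball_iso s (repr g) (repr g') -> U g'.
Proof.
split=> [oU g Ug|oU g Ug].
- have [e e0 eU] := oU g Ug.
  have [r re] : exists r, 2 ^- r < e.
    have := near_infty_natSinv_expn_lt (PosNum e0) => -[r _ /(_ r (leqnn _))] /=.
    by rewrite div1r => re; exists r.
  exists r => g' s rs gg'; apply: eU.
  apply: (@le_lt_trans _ _ (2 ^- s)%:E).
    by apply: ereal_inf_lbound; exists s.
  rewrite lte_fin; apply: le_lt_trans re.
  rewrite lef_pV2 ?posrE ?exprn_gt0// ler_eXn2l ?ltr1n//.
- have [r rU] := oU g Ug.
  exists (2 ^- r); first by rewrite invr_gt0 exprn_gt0.
  move=> g' /ereal_inf_lt[_ [s gg' <-]]; rewrite lte_fin => sr.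
  apply: (rU g' s) gg'.
  rewrite ltf_pV2 ?posrE ?exprn_gt0// ltr_eXn2l ?ltr1n// in sr.
  exact: ltnW.
Qed.

(** * Doubly rooted graphs *)

Section doubly_rooted.
Implicit Types (c : isoclass 2) (g : isoclass 1).

(** The graph and its two roots depend on the representative; [pr1], [pr2], [swap] and [edge] do
    not, as their values on [cls2 u v] show. *)
Definition graph2 c : cgraph := rgraph (repr c).
Definition root1 c : graph2 c := tnth (roots (repr c)) ord0.
Definition root2 c : graph2 c := tnth (roots (repr c)) ord_max.

Definition pr1 c : isoclass 1 := cls1 (root1 c).
Definition pr2 c : isoclass 1 := cls1 (root2 c).
Definition swap c : isoclass 2 := cls2 (root2 c) (root1 c).
Definition edge c : bool := adj (root1 c) (root2 c).

Lemma tuple2E (T : Type) (w : 2.-tuple T) : w = [tuple tnth w ord0; tnth w ord_max].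
Proof. by apply/val_inj; case: w => -[|a [|b []]]. Qed.

Lemma roots2E c : roots (repr c) = [tuple root1 c; root2 c].
Proof. exact: tuple2E. Qed.

Lemma cls2_roots c : cls2 (root1 c) (root2 c) = c.
Proof.
rewrite /cls2 -roots2E -[RHS]reprK /root1 /root2 /graph2.
by case: (repr c).
Qed.

Lemma repr_cls2 (G : cgraph) (u v : G) : exists phi : graph2 (cls2 u v) -> G,
  [/\ bijective phi, forall a b, adj (phi a) (phi b) = adj a b,
      phi (root1 (cls2 u v)) = u & phi (root2 (cls2 u v)) = v].
Proof.
have /asboolP[phi [bphi ephi rphi]] := repr_riso (@Rooted 2 G [tuple u; v]).
exists phi; split.
- by rewrite -setTT_bijective.
- by move=> a b; apply: ephi; rewrite in_setT.
- by move: rphi; rewrite roots2E /= => -[].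
- by move: rphi; rewrite roots2E /= => -[].
Qed.

Lemma pr1_cls2 (G : cgraph) (u v : G) : pr1 (cls2 u v) = cls1 u.
Proof.
have [phi [bphi ephi uE vE]] := repr_cls2 u v.
by rewrite -[in RHS]uE (cls_iso bphi ephi).1.
Qed.

Lemma pr2_cls2 (G : cgraph) (u v : G) : pr2 (cls2 u v) = cls1 v.
Proof.
have [phi [bphi ephi uE vE]] := repr_cls2 u v.
by rewrite -[in RHS]vE (cls_iso bphi ephi).1.
Qed.

Lemma swap_cls2 (G : cgraph) (u v : G) : swap (cls2 u v) = cls2 v u.
Proof.
have [phi [bphi ephi uE vE]] := repr_cls2 u v.
by rewrite /swap -(cls_iso bphi ephi).2 uE vE.
Qed.

Lemma edge_cls2 (G : cgraph) (u v : G) : edge (cls2 u v) = adj u v.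
Proof.
have [phi [bphi ephi uE vE]] := repr_cls2 u v.
by rewrite /edge -ephi uE vE.
Qed.

Lemma pr1_swap c : pr1 (swap c) = pr2 c.
Proof. by rewrite pr1_cls2. Qed.

Lemma pr2_swap c : pr2 (swap c) = pr1 c.
Proof. by rewrite pr2_cls2. Qed.

(** Almost sure statements about edges are made at the root of a class; this recovers any edge class
    as an edge at the root of its first endpoint. *)
Lemma edge_root c : edge c ->
  exists2 v, nbr (root_of (pr1 c)) v & cls2 (root_of (pr1 c)) v = c.
Proof.
move=> ec; set g := pr1 c.
have /riso_symm/asboolP[phi [bphi ephi rphi]] := repr_riso (@Rooted 1 _ [tuple root1 c]).
have bp : bijective phi by rewrite -setTT_bijective.
have ep a b : adj (phi a) (phi b) = adj a b by apply: ephi; rewrite in_setT.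
have r1 : phi (root1 c) = root_of g.
  by rewrite /root_of /thead (tnth_nth (phi (root1 c))) -rphi.
exists (phi (root2 c)); first by rewrite /nbr /= -r1 ep.
by rewrite -r1 (cls_iso bp ep).2 cls2_roots.
Qed.

End doubly_rooted.

(** * Continuity of rerooting maps *)

Section continuity.
Variable R : realType.

Lemma local_open_preimage k l (f : isoclass k -> isoclass l) :
  (forall c d s, ball_iso s (repr c) (repr d) ->
     ball_iso s (repr (f c)) (repr (f d))) ->
  forall U, local_open R U -> local_open R (f @^-1` U).
Proof.
move=> fP U /local_openP oU; apply/local_openP => g /oU[r rU].
by exists r => g' s rs gg'; apply: (rU _ s) => //; exact: fP.
Qed.

(** The new roots are chosen among the old ones, so the balls around them are contained in the old
    balls and the same isomorphism restricts. *)
Lemma ball_iso_reroot l s c d (w : l.-tuple 'I_2) :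
  ball_iso s (repr c) (repr d) ->
  ball_iso s
    (repr (\pi_(isoclass l) 
      (@Rooted l (graph2 c) [tuple of map (tnth (roots (repr c))) w])))
    (repr (\pi_(isoclass l) 
      (@Rooted l (graph2 d) [tuple of map (tnth (roots (repr d))) w]))).
Proof.
move=> [phi [bphi ephi rphi]]; apply: ball_iso_repr.
have E : [tuple of map phi [tuple of map (tnth (roots (repr c))) w]] =
   [tuple of map (tnth (roots (repr d))) w].
  apply/val_inj => /=; rewrite -map_comp; apply: eq_map => i /=.
  by rewrite -[RHS]/(tnth _ _) [in RHS](tnth_nth (phi (root1 c))) -rphi
    (nth_map (root1 c)) ?size_tuple// -tnth_nth.
rewrite -E; apply: (induced_iso_restrict bphi ephi).
- case: (repr c) => G r /=; apply: rball_roots => _ /mapP[i _ ->]; exact: mem_tnth.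
- rewrite E; case: (repr d) => G r /=.
  by apply: rball_roots => _ /mapP[i _ ->]; exact: mem_tnth.
Qed.

Lemma measurable_reroot l (f : isoclass 2 -> isoclass l) (w : l.-tuple 'I_2) :
  (forall c, f c = \pi_(isoclass l)
     (@Rooted l (graph2 c) [tuple of map (tnth (roots (repr c))) w])) ->
  measurable_fun setT (f : Gspace R 2 -> Gspace R l).
Proof.
move=> fE; apply: (measurability (@local_open R l : set (set (Gspace R l)))) => //.
move=> _ [U oU <-]; rewrite setTI; apply: sub_sigma_algebra.
apply: local_open_preimage oU => c d s cd.
by rewrite !fE; exact: ball_iso_reroot.
Qed.

Lemma measurable_pr1 : measurable_fun setT (pr1 : Gspace R 2 -> Gspace R 1).
Proof.
apply: (@measurable_reroot _ _ [tuple ord0]) => c; rewrite /pr1 /cls1.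
by congr (\pi_(isoclass 1) (Rooted _)); exact/val_inj.
Qed.

Lemma measurable_pr2 : measurable_fun setT (pr2 : Gspace R 2 -> Gspace R 1).
Proof.
apply: (@measurable_reroot _ _ [tuple ord_max]) => c; rewrite /pr1 /cls1.
by congr (\pi_(isoclass 1) (Rooted _)); exact/val_inj.
Qed.

Lemma measurable_cls_swap : measurable_fun setT (swap : Gspace R 2 -> Gspace R 2).
Proof.
apply: (@measurable_reroot _ _ [tuple ord_max; ord0]) => c; rewrite /swap /cls2.
by congr (\pi_(isoclass 2) (Rooted _)); exact/val_inj.
Qed.

Lemma measurable_edge : measurable ([set c | edge c] : set (Gspace R 2)).
Proof.
suff: local_open R [set c | edge c] by exact: sub_sigma_algebra.
(* Radius 0 suffices: both roots belong to every ball, and induced isomorphisms preserve their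
   adjacency. *)
apply/local_openP => c ec; exists 0%N => d s _.
move=> [phi [bphi ephi rphi]].
have [r1 r2] : phi (root1 c) = root1 d /\ phi (root2 c) = root2 d.
  by move: rphi; rewrite (roots2E c) (roots2E d) /= => -[].
move: ec; rewrite /= /edge -ephi ?r1 ?r2//.
- by apply/mem_set; exists (root1 c); split; [exact: mem_tnth|exists [::]].
- by apply/mem_set; exists (root2 c); split; [exact: mem_tnth|exists [::]].
Qed.

End continuity.

(** * Measurability of edge sums *)

Section edge_sum.
Implicit Types (g : isoclass 1).

Definition edge_sum (V : nmodType) (T : isoclass 2 -> V) g : V :=
  \sum_(v \in nbr (root_of g)) T (cls2 (root_of g) v).

Lemma nbr_finite (G : cgraph) (v : G) : finite_set (nbr v).
Proof. exact: adj_lfin. Qed.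

Lemma edge_sumE (V : nmodType) (T : isoclass 2 -> V) g : edge_sum T g =
  \sum_(v <- fset_set (nbr (root_of g))) T (cls2 (root_of g) v).
Proof. by rewrite /edge_sum fsbig_finite//; exact: nbr_finite. Qed.

Lemma nbr_fset (G : cgraph) (v u : G) : u \in fset_set (nbr v) = adj v u.
Proof.
by rewrite in_fset_set; [apply/idP/idP => [/set_mem|/mem_set]|exact: nbr_finite].
Qed.

Lemma eq_edge_sum (V : nmodType) (S T : isoclass 2 -> V) g :
  (forall v, nbr (root_of g) v -> S (cls2 (root_of g) v) = T (cls2 (root_of g) v)) ->
  edge_sum S g = edge_sum T g.
Proof. by move=> ST; apply: eq_fsbigr => v /set_mem; exact: ST. Qed.

Lemma edge_sumD (V : nmodType) (S T : isoclass 2 -> V) g :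
  edge_sum (fun c => S c + T c) g = edge_sum S g + edge_sum T g.
Proof. by rewrite !edge_sumE big_split. Qed.

Lemma edge_sumB (V : zmodType) (S T : isoclass 2 -> V) g :
  edge_sum (fun c => S c - T c) g = edge_sum S g - edge_sum T g.
Proof. by rewrite !edge_sumE big_split sumrN. Qed.

Variable R : realType.
Implicit Types S T : isoclass 2 -> R.

Lemma edge_sumZ a T g : edge_sum (fun c => a * T c) g = a * edge_sum T g.
Proof. by rewrite !edge_sumE mulr_sumr. Qed.

Lemma ler_edge_sum S T g :
  (forall v, nbr (root_of g) v -> S (cls2 (root_of g) v) <= T (cls2 (root_of g) v)) ->
  edge_sum S g <= edge_sum T g.
Proof.
move=> ST; rewrite !edge_sumE big_seq [leRHS]big_seq; apply: ler_sum => v.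
by rewrite nbr_fset => /ST.
Qed.

Lemma edge_sum_ge0 T g :
  (forall v, nbr (root_of g) v -> 0 <= T (cls2 (root_of g) v)) -> 0 <= edge_sum T g.
Proof.
move=> T0; rewrite edge_sumE big_seq; apply: sumr_ge0 => v.
by rewrite nbr_fset => /T0.
Qed.

Lemma ler_norm_edge_sum T g : `|edge_sum T g| <= edge_sum (fun c => `|T c|) g.
Proof. by rewrite !edge_sumE ler_norm_sum. Qed.

Lemma cvg_edge_sum (F : nat -> isoclass 2 -> R) T g :
  (forall c, F ^~ c @ \oo --> T c) -> edge_sum (F n) g @[n --> \oo] --> edge_sum T g.
Proof.
move=> FT; rewrite edge_sumE.
rewrite (_ : (fun n => _) = fun n =>
   \sum_(v <- fset_set (nbr (root_of g))) F n (cls2 (root_of g) v)); last first.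
  by apply/funext => n; rewrite edge_sumE.
by apply: cvg_big => [|v _]; [exact: add_continuous|exact: FT].
Qed.

Let count (B : set (isoclass 2)) := edge_sum (\1_B : isoclass 2 -> R).

(** The root has finitely many neighbours, so one radius serves all those counted at [g]; a ball
    isomorphism sends them injectively to neighbours counted at [g']. *)
Lemma edge_count_lsc B g : local_open R B -> exists r, forall g' s, (r <= s)%N ->
  ball_iso s (repr g) (repr g') -> count B g <= count B g'.
Proof.
move=> /local_openP oB; set o := root_of g.
have /choice[rr rrP] : forall v, exists r, B (cls2 o v) ->
    forall c s, (r <= s)%N -> ball_iso s (repr (cls2 o v)) (repr c) -> B c.
  move=> v; have [Bv|nB] := pselect (B (cls2 o v)); last by exists 0%N.
  by have [r rP] := oB _ Bv; exists r.
(* The successor pays for the step from [o] to [v]: the ball of radius [s] around the pair lies in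
   the ball of radius [s.+1] around [o]. *)
exists (\max_(v <- fset_set (nbr o)) rr v).+1 => g' [//|s] rs [phi [bphi ephi rphi]].
set o' := root_of g'.
have [fphi iphi sphi] := bphi.
have po : phi o = o'.
  by rewrite /o' /root_of /thead (tnth_nth (phi o)) -rphi (nth_map o) ?size_tuple// -tnth_nth.
have or : o \in roots (repr g) by exact: mem_tnth.
have nbr_ball r v : adj o v -> rball r.+1 (repr g) v.
  by move=> ov; exists o; split => //; exists [:: v]; rewrite /= ov.
have o_ball r : rball r.+1 (repr g) o by exists o; split => //; exists [::].
have near_ball (A : rooted 1) (a b : rgraph A) :
    a \in roots A -> adj a b -> rball s (@Rooted 2 _ [tuple a; b]) `<=` rball s.+1 A.
  move=> aw ab u [z [zab [p [pp lp sp]]]]; exists a; split=> //.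
  move: zab; rewrite !inE => /orP[|] /eqP zE.
    by rewrite zE in pp lp; exists p; split => //; exact: ltnW.
  by rewrite zE in pp lp; exists (b :: p); split => //=; rewrite ab.
have pnbr v : adj o v -> adj o' (phi v).
  by move=> ov; rewrite -po ephi//; apply/mem_set => //; exact: nbr_ball.
have pB v : adj o v -> B (cls2 o v) -> B (cls2 o' (phi v)).
  move=> ov Bv; apply: (rrP v Bv _ s).
    rewrite -ltnS; apply: leq_trans rs; rewrite ltnS.
    by apply: leq_bigmax_seq; rewrite ?nbr_fset.
  apply: ball_iso_repr.
  have := @induced_iso_restrict _ _ _ _ phi bphi ephi 2 [tuple o; v] s.
  have -> : [tuple of map phi [tuple o; v]] = [tuple o'; phi v].
    by apply/val_inj; rewrite /= po.
  apply.
  - exact: near_ball.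
  - by apply: near_ball; [exact: mem_tnth|exact: pnbr].
rewrite /count !edge_sumE -/o -/o'.
set F := fset_set (nbr o); set F' := fset_set (nbr o').
(* Neighbours of [o'] outside the image of [F] contribute nonnegative terms and are dropped. *)
rewrite [leRHS](bigID [in map phi F])/=.
apply: ler_wpDr; first by apply: sumr_ge0 => v _; rewrite indicE.
rewrite -[leRHS]big_filter (perm_big (map phi F)) /=; last first.
  apply: uniq_perm; first by rewrite filter_uniq// fset_uniq.
    rewrite map_inj_in_uniq ?fset_uniq// => u v.
    rewrite !nbr_fset => ou ov.
    by apply: iphi; apply/mem_set; exact: nbr_ball.
  move=> v; rewrite mem_filter andb_idr// => /mapP[u].
  by rewrite !nbr_fset => ou ->; exact: pnbr.
rewrite big_map big_seq [leRHS]big_seq; apply: ler_sum => v.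
rewrite nbr_fset => ov; rewrite !indicE ler_nat.
have [/set_mem Bv|//] := boolP (cls2 o v \in B).
by rewrite (mem_set (pB _ ov Bv)).
Qed.

(** Dynkin's argument: open sets are stable under intersection and have lower semicontinuous counts,
    while measurability of the count survives proper differences and increasing unions, edge sums
    being finite. *)
Lemma measurable_edge_count (B : set (isoclass 2)) :
  measurable (B : set (Gspace R 2)) ->
  measurable_fun setT (count B : Gspace R 1 -> R).
Proof.
pose L := [set B | measurable_fun setT (count B : Gspace R 1 -> R)].
have openL : local_open R (k:=2) `<=` L.
  move=> U oU; rewrite /L/=.
  apply: (measurability _ (RGenOInfty.measurableE R)) => //.
  move=> _ [_ [a ->] <-]; rewrite setTI.
  suff: local_open R (count U @^-1` `]a, +oo[) by exact: sub_sigma_algebra.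
  apply/local_openP => g; rewrite /= in_itv/= andbT => ag.
  have [r rP] := edge_count_lsc g oU; exists r => g' s rs gg'.
  by rewrite in_itv /= andbT; apply: lt_le_trans ag _; exact: rP gg'.
suff : <<s @local_open R 2 >> `<=` L by exact.
apply: lambda_system_subset => //.
- move=> U V /local_openP oU /local_openP oV; apply/local_openP => c [/oU[r rU] /oV[s sV]].
  exists (maxn r s) => d t; rewrite geq_max => /andP[rt st] cd.
  by split; [exact: (rU _ t)|exact: (sV _ t)].
- split => //.
  + by apply: openL; apply/local_openP => c _; exists 0%N.
  + move=> A C CA mA mC; rewrite /L/=.
    rewrite (_ : count _ = count A \- count C); first exact: measurable_funB.
    apply/funext => g /=; rewrite -edge_sumB; apply: eq_edge_sum => v _.
    rewrite !indicE in_setD.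
    have [/set_mem/CA/mem_set ->|_] := boolP (_ \in C);
      rewrite ?subrr ?subr0 ?andbF ?andbT//.
  + move=> F ndF mF; rewrite /L/=.
    apply: (@measurable_fun_cvg _ (Gspace R 1) R setT (fun n => count (F n))) => // g _.
    apply: cvg_edge_sum => c; apply/cvgrPdist_le => e e0.
    have [[n _ Fn]|nF] := pselect ((\bigcup_n F n) c).
      exists n => // m /= nm.
      have Fm : F m c by move: Fn; apply/subsetPset/ndF.
      have FU : (\bigcup_n F n) c by exists n.
      by rewrite !indicE (mem_set Fm) (mem_set FU) subrr normr0 ltW.
    exists 0%N => // m _ /=.
    have nFm : ~ F m c by move=> Fm; apply: nF; exists m.
    by rewrite !indicE (memNset nF) (memNset nFm) subrr normr0 ltW.
Qed.

Import HBSimple.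

(** For a simple function the edge sum is a finite combination of counts of level sets; pointwise
    limits pass through the finite edge sum. *)
Lemma measurable_edge_sum T : measurable_fun setT (T : Gspace R 2 -> R) ->
  measurable_fun setT (edge_sum T : Gspace R 1 -> R).
Proof.
move=> mT.
have [S ST] := approximation_sfun measurableT (iffRL (measurable_EFinP _ _) mT).
apply: (@measurable_fun_cvg _ (Gspace R 1) R setT
  (fun n => edge_sum (S n : isoclass 2 -> R))); last first.
  move=> g _.
  by apply: cvg_edge_sum => c; exact: (iffLR (fine_cvgP _ _) (ST c I)).2.
move=> n; rewrite (_ : edge_sum _ = fun g => \sum_(y <- fset_set (range (S n)))
   y * edge_sum (\1_(S n @^-1` [set y]) : isoclass 2 -> R) g).
  apply: measurable_sum => y; apply: measurable_funM => //.
  apply: measurable_edge_count; exact: measurable_sfunP.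
apply/funext => g; rewrite edge_sumE.
under [RHS]eq_bigr do rewrite -edge_sumZ edge_sumE.
rewrite exchange_big /=; apply: eq_bigr => v _.
by rewrite [LHS]fimfunE fsbig_finite.
Qed.
End edge_sum.

(** * Integration without measurability *)

Section lower_integral.
Context d (T : measurableType d) (R : realType) (mu : {measure set T -> \bar R}).
Implicit Types (f g : T -> \bar R) (u v A B : T -> R).
Import HBNNSimple.

(* No measurability is assumed: the integral of a nonnegative function is the
   supremum of the integrals of the simple functions below it. *)
Lemma le_integral_ae_ge0 f g : (forall x, 0 <= f x)%E -> (forall x, 0 <= g x)%E ->
  {ae mu, forall x, (f x <= g x)%E} -> (\int[mu]_x f x <= \int[mu]_x g x)%E.
Proof.
move=> f0 g0 [N [mN N0 NP]].
rewrite (ge0_integralTE mu f0) (ge0_integralTE mu g0).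
apply: ge_ereal_sup => _ [s sf <-].
(* Setting [s] to 0 on the null set [N] does not change its integral and puts it below [g]
   everywhere. *)
pose s' := mul_nnsfun s (indic_nnsfun R (measurableC mN)).
apply: (@le_trans _ _ (sintegral mu s')).
  rewrite -!integralT_nnsfun; apply: ae_ge0_le_integral => //.
  - by move=> x _; rewrite lee_fin.
  - by apply/measurable_EFinP; exact: measurable_funP.
  - by move=> x _; rewrite lee_fin.
  - by apply/measurable_EFinP; exact: measurable_funP.
  - exists N; split => // x; apply: contra_notP => xN _.
    have -> : s' x = s x * \1_(~` N) x by [].
    by rewrite indicE mem_set// mulr1.
apply: ereal_sup_ubound; exists s' => // x.
have -> : s' x = s x * \1_(~` N) x by [].
have [xN|xN] := pselect (N x).
  by rewrite indicE memNset ?mulr0//; exact.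
rewrite indicE mem_set// mulr1; apply: le_trans (sf x) _.
by move: xN; apply: contra_notP => ?; exact: NP.
Qed.

Lemma eq_integral_ae_ge0 f g : (forall x, 0 <= f x)%E -> (forall x, 0 <= g x)%E ->
  {ae mu, forall x, f x = g x} -> (\int[mu]_x f x = \int[mu]_x g x)%E.
Proof.
move=> f0 g0 fg; apply/eqP; rewrite eq_le; apply/andP; split;
  by apply: le_integral_ae_ge0 => //; apply: filterS fg => x ->.
Qed.

(** Positive and negative parts are compared separately, so integrands built from gradients need no
    measurability. *)
Lemma Rintegral_ae_eq u v : {ae mu, forall x, u x = v x} ->
  \int[mu]_x u x = \int[mu]_x v x.
Proof.
move=> uv; rewrite /Rintegral integralE [in RHS]integralE.
by congr (fine (_ - _)%E); apply: eq_integral_ae_ge0 => //;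
  apply: filterS uv => x ux; rewrite /= ?funeposE ?funenegE ux.
Qed.

Lemma Rintegral_ae_ge0 u : {ae mu, forall x, 0 <= u x} -> 0 <= \int[mu]_x u x.
Proof.
move=> u0; rewrite (@Rintegral_ae_eq _ (fun x => Num.max (u x) 0)).
  by apply: Rintegral_ge0 => x _; rewrite le_max lexx orbT.
by apply: filterS u0 => x u0; rewrite max_l.
Qed.

(* [A] need not be measurable: only the measurable function [(|u| - B)^+ <= A]
   is integrated. *)
Lemma integrable_dominated u A B : measurable_fun setT u ->
  (forall x, 0 <= A x) -> (\int[mu]_x (A x)%:E < +oo)%E ->
  mu.-integrable setT (EFin \o B) ->
  {ae mu, forall x, `|u x| <= A x + B x} -> mu.-integrable setT (EFin \o u).
Proof.
move=> mu_ A0 Aoo iB uAB.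
pose v x := Num.max (`|u x| - B x) 0.
have mB : measurable_fun setT B by apply/measurable_EFinP; exact: measurable_int iB.
have mv : measurable_fun setT v.
  by apply: measurable_maxr => //; apply: measurable_funB => //; exact: measurableT_comp.
have v0 x : 0 <= v x by rewrite le_max lexx orbT.
have iv : mu.-integrable setT (EFin \o v).
  apply/integrableP; split; first exact/measurable_EFinP.
  apply: le_lt_trans Aoo; apply: le_integral_ae_ge0 => //.
  apply: filterS uAB => x uAB; rewrite /= lee_fin ger0_norm// ge_max A0 andbT.
  by rewrite lerBlDr.
apply: (le_integrable measurableT _ _ (integrableD measurableT iv iB)).
  exact/measurable_EFinP.
move=> x _ /=; rewrite lee_fin; apply: le_trans (ler_norm _).
by rewrite -lerBlDr le_max lexx.
Qed.

Lemma integrable_le u B : measurable_fun setT u ->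
  mu.-integrable setT (EFin \o B) ->
  {ae mu, forall x, `|u x| <= B x} -> mu.-integrable setT (EFin \o u).
Proof.
move=> mu_ iB uB; apply: (@integrable_dominated u (cst 0) B) => //.
  by rewrite integral0 ltry.
by apply: filterS uB => x; rewrite add0r.
Qed.

Lemma integrable_add u v : mu.-integrable setT (EFin \o u) ->
  mu.-integrable setT (EFin \o v) -> mu.-integrable setT (EFin \o (fun x => u x + v x)).
Proof. by move=> iu iv; exact: (integrableD measurableT iu iv). Qed.

Lemma integrable_scale a u : mu.-integrable setT (EFin \o u) ->
  mu.-integrable setT (EFin \o (fun x => a * u x)).
Proof. by move=> iu; exact: (integrableZl measurableT a iu). Qed.

End lower_integral.

(** * Mass transport along edges *)

Section transport.
Variables (R : realType) (mu : probability (Gspace R 1) R).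
Hypothesis mu_unimodular : unimodular mu.
Implicit Types (T : isoclass 2 -> R) (u : isoclass 1 -> R) (Q : isoclass 2 -> Prop).

Lemma ae_sub (P P' : isoclass 1 -> Prop) : (forall g, P g -> P' g) ->
  {ae mu, forall g, P g} -> {ae mu, forall g, P' g}.
Proof. by move=> PP' HP; exact: (@filterS _ _ (ae_filter_ringOfSetsType mu) _ _ PP' HP). Qed.

Lemma ae_and (P P' : isoclass 1 -> Prop) : {ae mu, forall g, P g} ->
  {ae mu, forall g, P' g} -> {ae mu, forall g, P g /\ P' g}.
Proof.
by move=> HP HP'; exact: (@filterS2 _ _ (ae_filter_ringOfSetsType mu)
  _ _ _ (fun g => @conj (P g) (P' g)) HP HP').
Qed.

Let esum_nbr (G : cgraph) (v : G) (F : G -> R) : (forall w, 0 <= F w) ->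
  (\esum_(w in [set: G]) (if adj v w then F w else 0)%:E)%E =
  (\sum_(w \in nbr v) F w)%:E.
Proof.
move=> F0; rewrite -fsumEFin; last exact: nbr_finite.
rewrite -esum_fset; last by move=> w _; rewrite lee_fin.
  rewrite [RHS]esum_mkcond; apply: eq_esum => w _.
  by rewrite -nbr_fset in_fset_set; [case: ifP|exact: nbr_finite].
exact: nbr_finite.
Qed.

(** Unimodularity is applied to [T] cut off outside the edges, which reduces the sums over all
    vertices to sums over neighbours of the root. *)
Lemma integral_edge_sum_swap T : measurable_fun setT (T : Gspace R 2 -> R) ->
  (forall c, 0 <= T c) ->
  (\int[mu]_g (edge_sum T g)%:E = \int[mu]_g (edge_sum (T \o swap) g)%:E)%E.
Proof.
move=> mT T0.
have := @mu_unimodular (fun c => (if edge c then T c else 0)%:E).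
set I1 := (X in _ -> _ -> X = _); set I2 := (X in _ -> _ -> _ = X).
have -> : I1 = (\int[mu]_g (edge_sum T g)%:E)%E.
  apply: eq_integral => g _; rewrite -esum_nbr; last by move=> w; exact: T0.
  by apply: eq_esum => v _; rewrite edge_cls2.
have -> : I2 = (\int[mu]_g (edge_sum (T \o swap) g)%:E)%E.
  apply: eq_integral => g _; rewrite -esum_nbr; last by move=> w; exact: T0.
  by apply: eq_esum => v _; rewrite edge_cls2 adj_sym /= swap_cls2.
apply.
- apply/measurable_EFinP; 
    rewrite (_ : (fun c => _) = (\1_[set c | edge c] : isoclass 2 -> R) \* T).
    apply: measurable_funM => //; apply: measurable_indic; exact: measurable_edge.
  apply/funext => c /=; rewrite indicE; case: ifPn => ec.
    by rewrite mem_set// mul1r.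
  by rewrite memNset ?mul0r//=; exact/negP.
- by move=> c; rewrite lee_fin; case: ifP.
Qed.

Definition edge_ae Q : Prop :=
  {ae mu, forall g, forall v, nbr (root_of g) v -> Q (cls2 (root_of g) v)}.

(** By mass transport, the expected number of neighbours at which the rerooted graph falls in the
    null set [N] equals the integral of the degree over [N], which is 0. *)
Lemma edge_ae_swap Q : edge_ae Q -> edge_ae (Q \o swap).
Proof.
move=> [N [mN N0 NQ]].
pose T c : R := \1_N (pr1 c).
have T0 c : 0 <= T c by rewrite /T indicE.
have mT : measurable_fun setT (T : Gspace R 2 -> R).
  have mI : measurable_fun setT (\1_N : Gspace R 1 -> R) by exact: measurable_indic.
  exact: (measurableT_comp mI (@measurable_pr1 R)).
have mS := measurable_edge_sum (measurableT_comp mT (@measurable_cls_swap R)).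
have S0 g : 0 <= edge_sum (T \o swap) g by exact: edge_sum_ge0.
have : (\int[mu]_g `|(edge_sum (T \o swap) g)%:E| = 0)%E.
  rewrite -[RHS](integral0 mu setT).
  transitivity (\int[mu]_g (edge_sum (T \o swap) g)%:E)%E.
    by apply: eq_integral => g _; rewrite gee0_abs ?lee_fin.
  rewrite -integral_edge_sum_swap//; apply: eq_integral_ae_ge0 => //.
    by move=> g; rewrite lee_fin edge_sum_ge0.
  exists N; split => // g /=; apply: contra_notP => Ng.
  congr EFin; rewrite edge_sumE big1// => v _.
  by rewrite /T indicE pr1_cls2 cls1_root_of_of memNset.
move/(ae_eq_integral_abs mu measurableT (iffRL (measurable_EFinP _ _) mS)).
apply: filterS => g /(_ I)/= -[E0] v ov /=.
have Tv : T (cls2 v (root_of g)) = 0.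
  apply/eqP; rewrite eq_le T0 andbT -E0 edge_sumE.
  rewrite (bigD1_seq v) ?fset_uniq ?nbr_fset//= swap_cls2 lerDl.
  by apply: sumr_ge0 => w _; exact: T0.
rewrite swap_cls2.
(* The reversed edge is an edge at the root of its own class, and that class avoids [N], so [Q]
   holds there. *)
have [w ww <-] : exists2 w, nbr (root_of (pr1 (cls2 v (root_of g)))) w &
    cls2 (root_of (pr1 (cls2 v (root_of g)))) w = cls2 v (root_of g).
  by apply: edge_root; rewrite edge_cls2 adj_sym.
have : ~ N (pr1 (cls2 v (root_of g))).
  move: Tv; rewrite /T indicE.
  by case: (boolP (_ \in N)) => [_ /eqP|/negP nN _ /mem_set//]; rewrite ?oner_eq0.
by move/(subsetC NQ); rewrite setCK; apply.
Qed.

Definition edge_integrable T : Prop := measurable_fun setT (T : Gspace R 2 -> R) /\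
  mu.-integrable setT (EFin \o edge_sum (fun c => `|T c|)).

Lemma edge_integrable_sum T : edge_integrable T ->
  mu.-integrable setT (EFin \o edge_sum T).
Proof.
move=> [mT iT]; apply: (integrable_le _ iT); first exact: measurable_edge_sum.
by apply: aeW => g; exact: ler_norm_edge_sum.
Qed.

Lemma edge_integrable_le S T : measurable_fun setT (S : Gspace R 2 -> R) ->
  edge_integrable T -> edge_ae (fun c => `|S c| <= `|T c|) -> edge_integrable S.
Proof.
move=> mS [mT iT] ST; split => //; apply: (integrable_le _ iT).
  by apply: measurable_edge_sum; exact: measurableT_comp.
apply: ae_sub ST => g ST; rewrite ger0_norm ?edge_sum_ge0//.
exact: ler_edge_sum.
Qed.

Lemma edge_integrable_add S T : edge_integrable S -> edge_integrable T ->
  edge_integrable (fun c => S c + T c).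
Proof.
move=> [mS iS] [mT iT].
have mST : measurable_fun setT ((fun c => S c + T c) : Gspace R 2 -> R).
  exact: measurable_funD.
split => //.
apply: (integrable_le _ (integrable_add iS iT)).
  by apply: measurable_edge_sum; exact: measurableT_comp.
apply: aeW => g /=; rewrite ger0_norm ?edge_sum_ge0// -edge_sumD.
by apply: ler_edge_sum => v _; exact: ler_normD.
Qed.

Lemma edge_integrable_scale a T : edge_integrable T -> edge_integrable (fun c => a * T c).
Proof.
move=> [mT iT].
have maT : measurable_fun setT ((fun c => a * T c) : Gspace R 2 -> R).
  exact: measurable_funM.
split => //.
apply: (integrable_le _ (integrable_scale `|a| iT)).
  by apply: measurable_edge_sum; exact: measurableT_comp.
apply: aeW => g /=; rewrite ger0_norm ?edge_sum_ge0// -edge_sumZ.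
by apply: ler_edge_sum => v _; rewrite normrM.
Qed.

Lemma edge_integrable_swap T : edge_integrable T -> edge_integrable (T \o swap).
Proof.
move=> [mT iT]; have mTs := measurableT_comp mT (@measurable_cls_swap R).
split => //; apply/integrableP; split.
  by apply/measurable_EFinP; apply: measurable_edge_sum; exact: measurableT_comp.
move/integrableP : iT => [_].
have E (S : isoclass 2 -> R) :
    (\int[mu]_g `|(EFin \o edge_sum (fun c => `|S c|%R)) g| =
     \int[mu]_g (edge_sum (fun c => `|S c|%R) g)%:E)%E.
  by apply: eq_integral => g _; rewrite /= ger0_norm ?edge_sum_ge0.
by rewrite !E integral_edge_sum_swap//; exact: measurableT_comp.
Qed.

Lemma Rintegral_edge_sum_swap T : edge_integrable T ->
  \int[mu]_g edge_sum T g = \int[mu]_g edge_sum (T \o swap) g.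
Proof.
move=> iT.
(* Mass transport is available for nonnegative functions only, so the two parts of [T] are swapped
   separately. *)
pose P c := Num.max (T c) 0; pose N c := Num.max (- T c) 0.
have P0 c : 0 <= P c by rewrite le_max lexx orbT.
have N0 c : 0 <= N c by rewrite le_max lexx orbT.
have TPN c : T c = P c - N c.
  rewrite /P /N; have /orP[t0|t0] := le_total 0 (T c).
    by rewrite max_l// max_r ?subr0// oppr_le0.
  by rewrite max_r// max_l ?sub0r ?opprK// oppr_ge0.
have [mT _] := iT.
have mP : measurable_fun setT (P : Gspace R 2 -> R) by exact: measurable_maxr.
have mN : measurable_fun setT (N : Gspace R 2 -> R).
  by apply: measurable_maxr => //; exact: measurableT_comp.
have iP : edge_integrable P.
  apply: (edge_integrable_le mP iT); apply: aeW => g v _.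
  by rewrite ger0_norm// ge_max ler_norm normr_ge0.
have iN : edge_integrable N.
  apply: (edge_integrable_le mN iT); apply: aeW => g v _.
  by rewrite ger0_norm// ge_max ler_normr lexx orbT normr_ge0.
have E S : \int[mu]_g edge_sum (T \o S) g =
    \int[mu]_g (edge_sum (P \o S) g - edge_sum (N \o S) g).
  by apply: eq_Rintegral => g _; rewrite -edge_sumB; apply: eq_edge_sum => v _ /=.
have -> : \int[mu]_g edge_sum T g = \int[mu]_g edge_sum (T \o id) g by [].
rewrite !E RintegralB//; [|exact: edge_integrable_sum..].
rewrite RintegralB//;
  [|apply: edge_integrable_sum; exact: edge_integrable_swap..].
by rewrite /Rintegral -(integral_edge_sum_swap mP)// -(integral_edge_sum_swap mN).
Qed.

(** The edge sum is the degree of the root times [|u|]; this is where the degree bound enters. *)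
Lemma edge_integrable_pr1 u : bounded_degree mu ->
  mu.-integrable setT (EFin \o u) -> edge_integrable (u \o pr1).
Proof.
move=> [D dD] iu.
have mu_ : measurable_fun setT (u : Gspace R 1 -> R).
  by apply/measurable_EFinP; exact: measurable_int iu.
have mup := measurableT_comp mu_ (@measurable_pr1 R).
split => //; apply: (integrable_le _ (integrable_scale D%:R (integrable_norm iu))).
  by apply: measurable_edge_sum; exact: measurableT_comp.
apply: ae_sub dD => g /(_ (root_of g)) dD.
rewrite ger0_norm ?edge_sum_ge0// edge_sumE /=.
under eq_bigr do rewrite pr1_cls2 cls1_root_of_of.
rewrite big_const_seq count_predT iter_addr addr0 -[leLHS]mulr_natl.
by rewrite ler_wpM2r// ler_nat.
Qed.

End transport.

(** * Directional derivatives *)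

Section directional_limit.
Variable R : realType.
Implicit Types (u : nat -> R).

(* The value is junk when the sequence diverges; being total, it is measurable
   without any exceptional set. *)
Definition seq_lim u : R := fine (limn_esup (EFin \o u)).

Lemma seq_lim_cvg u l : u @ \oo --> l -> seq_lim u = l.
Proof.
move=> ul; have El : EFin (u n) @[n --> \oo] --> l%:E.
  by apply/fine_cvgP; split; [exact: nearW|exact: ul].
rewrite /seq_lim is_cvg_limn_esupE; last by apply/cvg_ex; exists l%:E.
by rewrite (cvg_lim _ El).
Qed.

Lemma measurable_seq_lim d (T : measurableType d) (u : nat -> T -> R) :
  (forall n, measurable_fun setT (u n)) ->
  measurable_fun setT (fun x => seq_lim (u ^~ x)).
Proof.
move=> mu_; apply: (measurableT_comp (fine_measurable measurableT)).
apply: (@measurable_fun_limn_esup _ _ _ _ (fun n x => (u n x)%:E)) => n.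
exact/measurable_EFinP.
Qed.

Variable V : normedModType R.
Implicit Types (f : V -> R) (a v : V).

Lemma is_derive_line f a v (t d : R) : is_derive (a + t *: v) v f d ->
  is_derive t 1 (fun s => f (a + s *: v)) d.
Proof.
case=> fd dE.
have E : (fun h : R =>
     h^-1 *: (((fun s => f (a + s *: v)) \o shift t) (h *: 1) - f (a + t *: v)))
   = (fun h : R => h^-1 *: ((f \o shift (a + t *: v)) (h *: v) - f (a + t *: v))).
  apply/funext => h /=; congr (_ *: (f _ - _)).
  by rewrite [h *: _]mulr1 scalerDl addrCA.
by split; [rewrite /derivable E|rewrite -dE /derive E].
Qed.

Lemma is_derive_seq f a v d : is_derive a v f d ->
  n.+1%:R * (f (a + n.+1%:R^-1 *: v) - f a) @[n --> \oo] --> d.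
Proof.
move=> [fd <-].
have h0 : (n.+1%:R^-1 : R) @[n --> \oo] --> 0^'.
  move=> A A0; have := @cvg_harmonic R (fun y => y != 0 -> A y) A0.
  by move=> [N _ NA]; exists N => // n /NA /=; apply; rewrite gt_eqF ?invr_gt0.
have := cvg_comp _ _ h0 fd; rewrite /comp => H.
by under eq_cvg => n do rewrite -[n.+1%:R in X in X * _]invrK [a + _]addrC.
Qed.

(** The mean value theorem on the segment replaces the increment by [t * D c] with [c] in []0, t[];
    the factor 1/2 of an integral remainder is not sought. *)
Lemma line_taylor f a v (D : R -> R) (L : R) :
  (forall t, is_derive (a + t *: v) v f (D t)) ->
  (forall t, 0 <= t <= 1 -> `|D t - D 0| <= L * t) ->
  forall t, 0 <= t <= 1 -> `|f (a + t *: v) - f a - t * D 0| <= L * t ^+ 2.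
Proof.
move=> fD DL t /andP[]; rewrite le_eqVlt => /predU1P[<- _|t0 t1].
  by rewrite scale0r addr0 subrr mul0r subr0 normr0 expr0n mulr0.
have fl (s : R) : is_derive s 1 (fun s => f (a + s *: v)) (D s) by exact: is_derive_line.
have [|c /[!in_itv]/= /andP[c0 ct]] := @MVT _ (fun s => f (a + s *: v)) D 0 t t0 (fun s _ => fl s).
  apply: derivable_within_continuous => s _; exact: ex_derive.
rewrite scale0r addr0 subr0 => ->.
rewrite [t * _]mulrC -mulrBl normrM (gtr0_norm t0) expr2 mulrA ler_wpM2r ?(ltW t0)//.
have L0 : 0 <= L.
  by have := DL 1; rewrite ler01 lexx mulr1 => /(_ isT); apply: le_trans.
by apply: le_trans (DL c _) _; [lra|rewrite ler_wpM2l// ltW].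
Qed.

End directional_limit.

(** * First-order conditions in one variable *)

Section tangent.
Variable R : realType.

(** For each [e] a single small [t] is required, which is weaker than differentiability at 0. It
    covers both root costs, which are differentiable along lines, and the potential, for which a
    quadratic remainder is known. *)
Definition tangent (q : R -> R) (d : R) : Prop := forall e, 0 < e ->
  exists2 t, 0 < t <= 1 & `|q t - q 0 - t * d| <= e * t.

Lemma tangent_derive q d : is_derive (0 : R) 1 q d -> tangent q d.
Proof.
move=> [qd <-] e e0.
have /cvgrPdist_le/(_ e e0) := qd; move=> /nbhs_ballP[r /= r0 rP].
pose t := Num.min (r / 2) 1.
have t0 : 0 < t by rewrite lt_min divr_gt0// ltr01.
exists t; first by rewrite t0 ge_min lexx orbT.
have tr : ball (0 : R) r t.
  rewrite /ball /= sub0r normrN gtr0_norm// gt_min; apply/orP; left.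
  by rewrite ltr_pdivrMr// ltr_pMr// ltr1n.
have := rP t tr (lt0r_neq0 t0); rewrite -/(derive _ _ _).
rewrite /= addr0 [t *: _]mulr1 distrC => H.
have -> : q t - q 0 - t * 'D_1 q 0 = t * (t^-1 * (q t - q 0) - 'D_1 q 0).
  by rewrite mulrBr mulVKf ?gt_eqF.
by rewrite normrM (gtr0_norm t0) mulrC ler_wpM2r// ltW.
Qed.

Lemma tangent_quadratic q d C : 0 <= C ->
  (forall t, 0 <= t <= 1 -> `|q t - q 0 - t * d| <= C * t ^+ 2) -> tangent q d.
Proof.
(* This [t] gives [C * t <= e]; adding 1 keeps the denominator positive when [C = 0]. *)
move=> C0 qC e e0; pose t := Num.min (e / (C + 1)) 1.
have t0 : 0 < t by rewrite lt_min ltr01 divr_gt0// ltr_wpDl.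
have t1 : t <= 1 by rewrite ge_min lexx orbT.
exists t; first by rewrite t0.
apply: le_trans (qC t _) _; first by rewrite (ltW t0).
rewrite expr2 mulrA ler_wpM2r ?(ltW t0)//.
apply: (@le_trans _ _ ((C + 1) * t)); first by rewrite ler_wpM2r ?(ltW t0)// lerDl.
by rewrite mulrC -ler_pdivlMr ?ltr_wpDl// ge_min lexx.
Qed.

Lemma tangent_ge0 q d : tangent q d ->
  (forall t, 0 < t <= 1 -> q 0 <= q t) -> 0 <= d.
Proof.
move=> qd q0; rewrite leNgt; apply/negP => d0.
(* With this error, [q t - q 0] is at most [t * d / 2], which is negative. *)
have [|t t01] := qd (- d / 2); first lra.
have := q0 t t01; case/andP: t01 => t0 t1; rewrite ler_norml => ? /andP[_ ?]; nra.
Qed.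

Lemma tangent_convex q d : tangent q d -> 0 <= d ->
  (forall t, 0 < t <= 1 -> q t <= (1 - t) * q 0 + t * q 1) -> q 0 <= q 1.
Proof.
move=> qd d0 qc; rewrite leNgt; apply/negP => q10.
(* Convexity makes [q] drop by at least [t * (q 0 - q 1)], while [0 <= d] and this error allow a
   drop of at most half of that. *)
have [|t t01] := qd ((q 0 - q 1) / 2); first lra.
have := qc t t01; case/andP: t01 => t0 t1; rewrite ler_norml => ? /andP[? _]; nra.
Qed.

End tangent.

(** * Hilbert space *)

Section hilbert.
Variables (R : realType) (H : completeNormedModType R) (dot : {dot H for idfun}).
Hypothesis dot_norm : forall a : H, dot a a = `|a| ^+ 2.
Implicit Types (a b c : H).

Lemma dotC a b : dot a b = dot b a.
Proof. by rewrite hermC expr0 mul1r. Qed.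

Lemma dotDl a b c : dot (a + b) c = dot a c + dot b c.
Proof. exact: linearDl. Qed.

Lemma dotZl t a c : dot (t *: a) c = t * dot a c.
Proof. exact: linearZl_LR. Qed.

Lemma dotDr a b c : dot a (b + c) = dot a b + dot a c.
Proof. by rewrite dotC dotDl !(dotC a). Qed.

Lemma dotZr t a c : dot a (t *: c) = t * dot a c.
Proof. by rewrite dotC dotZl (dotC a). Qed.

Lemma dotBl a b c : dot (a - b) c = dot a c - dot b c.
Proof. by rewrite dotDl -scaleN1r dotZl mulN1r. Qed.

Lemma dotBr a b c : dot a (b - c) = dot a b - dot a c.
Proof. by rewrite dotDr -scaleN1r dotZr mulN1r. Qed.

Lemma dot0l c : dot 0 c = 0.
Proof. by rewrite -(scale0r (0 : H)) dotZl mul0r. Qed.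

Lemma dot_suml (I : Type) (s : seq I) (F : I -> H) c :
  dot (\sum_(i <- s) F i) c = \sum_(i <- s) dot (F i) c.
Proof. by apply: (big_morph (dot ^~ c)) => [a b|]; [exact: dotDl|exact: dot0l]. Qed.

Lemma cauchy_schwarz a b : `|dot a b| <= `|a| * `|b|.
Proof.
have [->|b0] := eqVneq b 0; first by rewrite dotC dot0l !normr0 mulr0.
have nb : 0 < `|b| by rewrite normr_gt0.
have : 0 <= dot (`|b| ^+ 2 *: a - dot a b *: b) (`|b| ^+ 2 *: a - dot a b *: b).
  by rewrite dot_norm sqr_ge0.
rewrite dotBl !dotBr !dotZl !dotZr !dot_norm (dotC b a) => H0.
have H1 : dot a b ^+ 2 <= (`|a| * `|b|) ^+ 2.
  have : 0 <= `|b| ^+ 2 * (`|a| ^+ 2 * `|b| ^+ 2 - dot a b ^+ 2).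
    by apply: le_trans H0 _; rewrite le_eqVlt; apply/orP; left; apply/eqP; lra.
  by rewrite pmulr_rge0 ?exprn_gt0// subr_ge0 exprMn.
by rewrite -ler_sqr ?nnegrE ?mulr_ge0// real_normK// num_real.
Qed.

Lemma dot_le a b : dot a b <= `|a| * `|b|.
Proof. exact: le_trans (ler_norm _) (cauchy_schwarz a b). Qed.

Lemma normD_sqr_le a b : `|a + b| ^+ 2 <= 2 * (`|a| ^+ 2 + `|b| ^+ 2).
Proof.
have := dot_norm (a + b); rewrite dotDl !dotDr (dotC b a) !dot_norm => <-.
have := dot_le a b; have := sqr_ge0 (`|a| - `|b|); nra.
Qed.

Lemma gradientP (f : H -> R) a : gateaux_differentiable dot f ->
  is_gradient dot f a (gradient dot f a).
Proof. by move=> df; apply: xgetPex; exact: df. Qed.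

Hypothesis H_separable : separable H.

(* By separability an open subset of [H * H] is a countable union of products
   of balls, so that continuous operations preserve measurability. *)
Lemma measurable_continuous2 d (T : measurableType d) (x y : T -> H)
    (F : H * H -> H) :
  continuous F -> measurable_fun setT (x : T -> borel H) ->
  measurable_fun setT (y : T -> borel H) ->
  measurable_fun setT ((fun t => F (x t, y t)) : T -> borel H).
Proof.
move=> cF mx my.
have [S cS dS] := H_separable.
apply: (measurability (@open H : set (set (borel H)))) => // _ [U oU <-]; rewrite setTI.
have oFU : open (F @^-1` U) by move/continuousP : cF; exact.
pose B (a : H) (n : nat) := ball a (n.+1%:R^-1 : R).
have oB a n : open (B a n) by exact: ball_open.
have mB z a n : measurable_fun setT (z : T -> borel H) -> measurable (z @^-1` B a n).
  move=> mz; rewrite -[X in measurable X]setTI; apply: mz => //.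
  exact: sub_sigma_algebra.
pose I := S `*` S `*` [set: nat].
have cI : countable I by do 2 apply: countableX => //; exact: countableP.
pose P (i : H * H * nat) := B i.1.1 i.2 `*` B i.1.2 i.2 `<=` F @^-1` U.
rewrite (_ : _ @^-1` U = \bigcup_(i in I `&` P)
    ((x @^-1` B i.1.1 i.2) `&` (y @^-1` B i.1.2 i.2))); last first.
  apply/seteqP; split => [t Ut|t [i [_ Pi] [xi yi]]]; last exact: (Pi (x t, y t)).
  have [e /= e0 eU] : exists2 e : R, 0 < e & ball (x t, y t) e `<=` F @^-1` U.
    by have /nbhs_ballP[e e0 eU] := open_nbhs_nbhs (conj oFU Ut); exists e.
  have [n ne] : exists n, (n.+1%:R^-1 : R) < e / 2.
    have /cvgrPdist_lt/(_ (e / 2)) := @cvg_harmonic R.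
    rewrite divr_gt0// => /(_ isT)[n _ /(_ n (leqnn n))]/=.
    by rewrite sub0r normrN gtr0_norm ?invr_gt0//; exists n.
  have near_S z : exists2 s, S s & B z n s.
    have [] := dS (B z n) _ (oB z n); first by exists z; exact: ballxx.
    by move=> s [Bs Ss]; exists s.
  have [s Ss xs] := near_S (x t); have [s' Ss' ys] := near_S (y t).
  exists ((s, s'), n); last by split; exact: ball_sym.
  split=> // -[a b] /= [sa s'b]; apply: eU.
  have tri (z s0 z' : H) : B z n s0 -> B s0 n z' -> ball z e z'.
    move=> zs sz; have := ball_triangle zs sz; apply: le_ball.
    by rewrite [e]splitr lerD// ltW.
  by split; [exact: tri xs sa|exact: tri ys s'b].
rewrite bigcup_set_type; apply: countable_bigcupT_measurable => [|i].
  rewrite (eq_countable (card_setT _)).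
  exact: sub_countable (subset_card_le (@subIsetl _ _ _)) cI.
by apply: measurableI; exact: mB.
Qed.

Lemma measurable_axpy d (T : measurableType d) (x y : T -> H) (t : R) :
  measurable_fun setT (x : T -> borel H) -> measurable_fun setT (y : T -> borel H) ->
  measurable_fun setT ((fun s => x s + t *: y s) : T -> borel H).
Proof.
move=> mx my; apply: (measurable_continuous2 (F := fun p => p.1 + t *: p.2)) => // p.
by apply: cvgD; [exact: cvg_fst|apply: cvgZl_tmp; exact: cvg_snd].
Qed.

Lemma measurable_normH d (T : measurableType d) (x : T -> H) :
  measurable_fun setT (x : T -> borel H) -> measurable_fun setT (fun s => `|x s| : R).
Proof.
move=> mx; apply: (measurability _ (RGenOpens.measurableE R)) => //.
move=> _ [_ [a [b ->]] <-]; rewrite setTI.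
rewrite (_ : _ @^-1` _ = x @^-1` ((fun z : H => `|z|) @^-1` `]a, b[)); last by [].
rewrite -[X in measurable X]setTI; apply: mx => //; apply: sub_sigma_algebra.
have /continuousP : continuous (fun z : H => `|z|) by exact: norm_continuous.
by apply; exact: interval_open.
Qed.

End hilbert.

(** * Second order remainders *)

Section gradients.
Variables (R : realType) (H : completeNormedModType R) (dot : {dot H for idfun}).
Hypothesis dot_norm : forall a : H, dot a a = `|a| ^+ 2.
Variables (h psi : isoclass 2 -> H -> H -> R) (Lh : R).
Hypothesis Lh0 : 0 <= Lh.
Implicit Types (c : isoclass 2).

Lemma quadratic_remainder (f : H -> R) (L : R) a v t :
  gateaux_differentiable dot f ->
  (forall a b, `|gradient dot f a - gradient dot f b| <= L * `|a - b|) ->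
  0 <= t <= 1 ->
  `|f (a + t *: v) - f a - t * dot (gradient dot f a) v| <= L * `|v| ^+ 2 * t ^+ 2.
Proof.
move=> df Lf t01.
have := @line_taylor R H f a v (fun s => dot (gradient dot f (a + s *: v)) v)
  (L * `|v| ^+ 2) _ _ t t01.
rewrite scale0r addr0; apply.
  by move=> s; apply: gradientP.
move=> s /andP[s0 s1]; rewrite -dotBl.
apply: le_trans (cauchy_schwarz dot_norm _ _) _.
apply: (@le_trans _ _ (L * `|a + s *: v - a| * `|v|)); first by rewrite ler_wpM2r.
by rewrite addrAC subrr add0r normrZ ger0_norm// expr2 le_eqVlt;
  apply/orP; left; apply/eqP; lra.
Qed.

(** The edge hypotheses are gathered as a property of the class [c] alone, so that [edge_ae_swap]
    yields them for [swap c] too. *)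
Definition regular_edge c : Prop :=
  [/\ forall b, gateaux_differentiable dot (h c ^~ b),
      gateaux_differentiable (dot_prod dot) (fun p => psi c p.1 p.2),
      forall a b, grad1 dot psi c a b = grad1 dot h c a b,
      forall a b, grad2 dot psi c a b = grad1 dot h (swap c) b a &
      forall a a' b b', `|grad1 dot h c a b - grad1 dot h c a' b'|
        <= Lh * (`|a - a'| + `|b - b'|)].

Lemma is_derive_comp_line (V W : normedModType R) (F : V -> R) (G : W -> R)
    (a v : V) (b w : W) d :
  (forall s : R, F (s *: v + a) = G (s *: w + b)) ->
  is_derive b w G d -> is_derive a v F d.
Proof.
move=> FG [Gd <-].
have E : (fun s : R => s^-1 *: ((F \o shift a) (s *: v) - F a)) =
    (fun s : R => s^-1 *: ((G \o shift b) (s *: w) - G b)).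
  apply/funext => s; congr (_ *: (_ - _)); first exact: FG.
  by have := FG 0; rewrite !scale0r !add0r.
by split; [rewrite /derivable E|rewrite /derive E].
Qed.

(** The components of the joint gradient of [psi] are gradients along the coordinates, and
    admissibility identifies these with gradients of [h] at the two ends of the edge. *)
Lemma is_derive_psi c a b v w : regular_edge c ->
  is_derive ((a, b) : H * H) ((v, w) : H * H) (fun p => psi c p.1 p.2)
    (dot (grad1 dot h c a b) v + dot (grad1 dot h (swap c) b a) w).
Proof.
move=> [_ dpsi g1 g2 _]; have [p pP] := dpsi (a, b).
have d1 u : is_derive a u (psi c ^~ b) (dot p.1 u).
  apply: (@is_derive_comp_line _ _ _ (fun q => psi c q.1 q.2) _ _ (a, b) (u, 0)) => [s|].
    by rewrite /= scaler0 add0r.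
  by have := pP (u, 0); rewrite /dot_prod /= (dotC dot _ 0) dot0l addr0.
have d2 u : is_derive b u (psi c a) (dot p.2 u).
  apply: (@is_derive_comp_line _ _ _ (fun q => psi c q.1 q.2) _ _ (a, b) (0, u)) => [s|].
    by rewrite /= scaler0 add0r.
  by have := pP (0, u); rewrite /dot_prod /= (dotC dot _ 0) dot0l add0r.
have gr1 : is_gradient dot (psi c ^~ b) a (grad1 dot psi c a b).
  by apply: (@xgetPex _ _ [set q | is_gradient dot (psi c ^~ b) a q]); exists p.1.
have gr2 : is_gradient dot (psi c a) b (grad2 dot psi c a b).
  by apply: (@xgetPex _ _ [set q | is_gradient dot (psi c a) b q]); exists p.2.
have e1 : dot (grad1 dot h c a b) v = dot p.1 v.
  by rewrite -g1; have [_ <-] := gr1 v; have [_ <-] := d1 v.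
have e2 : dot (grad1 dot h (swap c) b a) w = dot p.2 w.
  by rewrite -g2; have [_ <-] := gr2 w; have [_ <-] := d2 w.
by rewrite e1 e2; exact: pP.
Qed.

(** Both orientations are needed since the second partial gradient of [psi] is that of [h] on the
    reversed edge. The factor 2 bounds the square of [|v| + |w|] by squares. *)
Lemma psi_remainder c a b v w t : regular_edge c -> regular_edge (swap c) ->
  0 <= t <= 1 ->
  `|psi c (a + t *: v) (b + t *: w) - psi c a b
    - t * (dot (grad1 dot h c a b) v + dot (grad1 dot h (swap c) b a) w)|
  <= 2 * Lh * (`|v| ^+ 2 + `|w| ^+ 2) * t ^+ 2.
Proof.
move=> rc rs t01.
have := @line_taylor R (H * H)%type (fun p => psi c p.1 p.2) (a, b) (v, w)
  (fun s => dot (grad1 dot h c (a + s *: v) (b + s *: w)) v +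
            dot (grad1 dot h (swap c) (b + s *: w) (a + s *: v)) w)
  (2 * Lh * (`|v| ^+ 2 + `|w| ^+ 2)) _ _ t t01.
rewrite /= !scale0r !addr0; apply; first by move=> s; exact: is_derive_psi.
move=> s /andP[s0 s1].
have [_ _ _ _ lc] := rc; have [_ _ _ _ ls] := rs.
have nZ (z z' : H) : `|z + s *: z' - z| = s * `|z'|.
  by rewrite addrAC subrr add0r normrZ ger0_norm.
have B1 : `|dot (grad1 dot h c (a + s *: v) (b + s *: w)) v - dot (grad1 dot h c a b) v|
    <= Lh * (s * `|v| + s * `|w|) * `|v|.
  rewrite -dotBl; apply: le_trans (cauchy_schwarz dot_norm _ _) _.
  by rewrite ler_wpM2r//; apply: le_trans (lc _ _ _ _) _; rewrite !nZ.
have B2 : `|dot (grad1 dot h (swap c) (b + s *: w) (a + s *: v)) w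
      - dot (grad1 dot h (swap c) b a) w|
    <= Lh * (s * `|w| + s * `|v|) * `|w|.
  rewrite -dotBl; apply: le_trans (cauchy_schwarz dot_norm _ _) _.
  by rewrite ler_wpM2r//; apply: le_trans (ls _ _ _ _) _; rewrite !nZ.
rewrite opprD addrACA; apply: le_trans (ler_normD _ _) _.
apply: le_trans (lerD B1 B2) _.
have -> : Lh * (s * `|v| + s * `|w|) * `|v| + Lh * (s * `|w| + s * `|v|) * `|w| =
   (Lh * s) * (`|v| + `|w|) ^+ 2 by lra.
rewrite (_ : 2 * Lh * _ * s = (Lh * s) * (2 * (`|v| ^+ 2 + `|w| ^+ 2))); last by lra.
rewrite ler_wpM2l ?mulr_ge0//.
have := sqr_ge0 (`|v| - `|w|); nra.
Qed.

End gradients.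

(** * The potential *)

Section potential.
Variables (R : realType) (H : completeNormedModType R) (dot : {dot H for idfun}).
Hypothesis dot_norm : forall a : H, dot a a = `|a| ^+ 2.
Hypothesis H_separable : separable H.
Variable mu : probability (Gspace R 1) R.
Hypothesis mu_unimodular : unimodular mu.
Hypothesis mu_bounded : bounded_degree mu.
Variables (f : isoclass 1 -> H -> R) (h psi : isoclass 2 -> H -> H -> R).
Implicit Types (x y z : isoclass 1 -> H) (g : isoclass 1) (c : isoclass 2).

Let integrable1 (u : isoclass 1 -> R) := mu.-integrable setT (EFin \o u).

Lemma L2P x : L2 mu x <->
  measurable_fun setT (x : Gspace R 1 -> borel H) /\ integrable1 (fun g => `|x g| ^+ 2).
Proof.
split=> -[mx ix]; split => //.
  apply/integrableP; split.
    by apply/measurable_EFinP/measurable_funX; exact: measurable_normH.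
  by under eq_integral do rewrite /= ger0_norm ?sqr_ge0//.
by move/integrableP : ix => [_]; under eq_integral do rewrite /= ger0_norm ?sqr_ge0//.
Qed.

Lemma L2_cst (a : H) : L2 mu (cst a : isoclass 1 -> H).
Proof.
apply/L2P; split => //.
exact: (@finite_measure_integrable_cst _ _ _ mu setT (`|a| ^+ 2)).
Qed.

Lemma L2_axpy x y t : L2 mu x -> L2 mu y -> L2 mu (fun g => x g + t *: y g).
Proof.
move=> /L2P[mx ix] /L2P[my iy]; apply/L2P.
have mxy := measurable_axpy H_separable t mx my.
split => //.
apply: (integrable_le _ (integrable_scale 2 (integrable_add ix (integrable_scale (t ^+ 2) iy)))).
- by apply: measurable_funX; exact: measurable_normH mxy.
- apply: aeW => g; rewrite ger0_norm ?sqr_ge0//.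
  apply: le_trans (normD_sqr_le dot_norm _ _) _.
  by rewrite normrZ exprMn real_normK ?num_real.
Qed.

Lemma L2B x y : L2 mu x -> L2 mu y -> L2 mu (fun g => x g - y g).
Proof.
move=> Lx Ly; have := L2_axpy (-1) Lx Ly; congr (L2 mu _).
by apply/funext => g; rewrite scaleN1r.
Qed.

Lemma L2_edge_integrable x : L2 mu x ->
  edge_integrable mu (fun c => `|x (pr1 c)| ^+ 2) /\
  edge_integrable mu (fun c => `|x (pr2 c)| ^+ 2).
Proof.
move=> /L2P[_ ix]; have I1 := edge_integrable_pr1 mu_bounded ix.
split; first exact: I1.
have := edge_integrable_swap mu_unimodular I1; congr (edge_integrable mu _).
by apply/funext => c; rewrite /= pr1_swap.
Qed.

Hypothesis mf : measurable_fun setT (fun p : Gspace R 1 * borel H => f p.1 p.2).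
Hypothesis mh : measurable_fun setT
  (fun p : Gspace R 2 * borel H * borel H => h p.1.1 p.1.2 p.2).
Hypothesis mpsi : measurable_fun setT
  (fun p : Gspace R 2 * borel H * borel H => psi p.1.1 p.1.2 p.2).

Lemma measurable_comp_f x : measurable_fun setT (x : Gspace R 1 -> borel H) ->
  measurable_fun setT ((fun g => f g (x g)) : Gspace R 1 -> R).
Proof.
move=> mx; have := measurableT_comp mf (measurable_fun_pair (@measurable_id _ _ setT) mx).
exact.
Qed.

Lemma measurable_comp_edge (k : isoclass 2 -> H -> H -> R) (x y : isoclass 2 -> H) :
  measurable_fun setT (fun p : Gspace R 2 * borel H * borel H => k p.1.1 p.1.2 p.2) ->
  measurable_fun setT (x : Gspace R 2 -> borel H) ->
  measurable_fun setT (y : Gspace R 2 -> borel H) ->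
  measurable_fun setT ((fun c => k c (x c) (y c)) : Gspace R 2 -> R).
Proof.
move=> mk mx my.
have mxy := measurable_fun_pair (measurable_fun_pair (@measurable_id _ _ setT) mx) my.
exact: (measurableT_comp mk mxy).
Qed.

Definition dvertex x y g : R := seq_lim (fun n =>
  n.+1%:R * (f g (x g + n.+1%:R^-1 *: y g) - f g (x g))).

(** Only the action at the first root moves; the variation at the other end is
    [dedge x y \o swap]. *)
Definition dedge x y c : R := seq_lim (fun n =>
  n.+1%:R * (h c (x (pr1 c) + n.+1%:R^-1 *: y (pr1 c)) (x (pr2 c))
             - h c (x (pr1 c)) (x (pr2 c)))).

Lemma measurable_dvertex x y : L2 mu x -> L2 mu y ->
  measurable_fun setT (dvertex x y : Gspace R 1 -> R).
Proof.
move=> [mx _] [my _].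
apply: (@measurable_seq_lim _ _ (Gspace R 1) (fun n g =>
  n.+1%:R * (f g (x g + n.+1%:R^-1 *: y g) - f g (x g)))) => n.
apply: measurable_funM => //; apply: measurable_funB; apply: measurable_comp_f => //.
exact: measurable_axpy.
Qed.

Lemma measurable_dedge x y : L2 mu x -> L2 mu y ->
  measurable_fun setT (dedge x y : Gspace R 2 -> R).
Proof.
move=> [mx _] [my _].
have mx1 := measurableT_comp mx (@measurable_pr1 R).
have my1 := measurableT_comp my (@measurable_pr1 R).
have mx2 := measurableT_comp mx (@measurable_pr2 R).
apply: (@measurable_seq_lim _ _ (Gspace R 2) (fun n c =>
  n.+1%:R * (h c (x (pr1 c) + n.+1%:R^-1 *: y (pr1 c)) (x (pr2 c))
             - h c (x (pr1 c)) (x (pr2 c))))) => n.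
apply: measurable_funM => //; apply: measurable_funB; apply: measurable_comp_edge => //.
exact: measurable_axpy.
Qed.

Variables (Lf Lh : R).
Hypotheses (Lf0 : 0 <= Lf) (Lh0 : 0 <= Lh).

Definition regular_vertex g : Prop := gateaux_differentiable dot (f g) /\
  forall a a', `|gradient dot (f g) a - gradient dot (f g) a'| <= Lf * `|a - a'|.

Local Notation regular_edge := (regular_edge dot h psi Lh).

Hypothesis vertex_ok : {ae mu, forall g, regular_vertex g}.
Hypothesis edge_ok : edge_ae mu regular_edge.

Let edge_ok' : edge_ae mu (regular_edge \o swap) := edge_ae_swap mu_unimodular edge_ok.

Lemma dvertexE x y g : regular_vertex g ->
  dvertex x y g = dot (gradient dot (f g) (x g)) (y g).
Proof.
by move=> [df _]; apply/seq_lim_cvg/is_derive_seq; exact: gradientP.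
Qed.

Lemma dedgeE x y c : regular_edge c ->
  dedge x y c = dot (grad1 dot h c (x (pr1 c)) (x (pr2 c))) (y (pr1 c)).
Proof.
move=> [dh _ _ _ _].
apply: seq_lim_cvg; apply: (@is_derive_seq R H (h c ^~ (x (pr2 c)))).
rewrite /grad1; apply: (@gradientP _ _ dot (h c ^~ (x (pr2 c)))); exact: dh.
Qed.

Variable a0 : H.
Hypotheses (f_a0 : (\int[mu]_g (`|f g a0|)%:E < +oo)%E)
  (df_a0 : (\int[mu]_g (`|gradient dot (f g) a0| ^+ 2)%:E < +oo)%E)
  (psi_a0 : (\int[mu]_g (edge_sum (fun c => `|psi c a0 a0|%R) g)%:E < +oo)%E)
  (dh_a0 : (\int[mu]_g (edge_sum (fun c => `|grad1 dot h c a0 a0|%R ^+ 2) g)%:E < +oo)%E).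

(** The Lipschitz bound compares the gradient with its value at [a0]. The squared norm of the latter
    has finite integral without being known measurable, hence [integrable_dominated]. *)
Lemma integrable_dvertex x y : L2 mu x -> L2 mu y -> integrable1 (dvertex x y).
Proof.
move=> Lx Ly; have /L2P[_ iy] := Ly.
have /L2P[_ ix] := L2B Lx (L2_cst a0).
apply: (integrable_dominated (measurable_dvertex Lx Ly) _ df_a0
  (integrable_add (integrable_scale Lf ix) (integrable_scale (1 + Lf) iy))).
  by move=> g; exact: sqr_ge0.
apply: ae_sub vertex_ok => g vg; rewrite dvertexE//.
apply: le_trans (cauchy_schwarz dot_norm _ _) _.
have [_ /(_ (x g) a0) L] := vg.
set p := gradient _ _ _ in L *; set q := gradient _ _ _ in L *.
have pq : `|p| <= Lf * `|x g - a0| + `|q|.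
  by rewrite -lerBlDr; apply: le_trans (lerB_dist _ _) L.
have {}pq : `|p| * `|y g| <= (Lf * `|x g - a0| + `|q|) * `|y g| by rewrite ler_wpM2r.
apply: le_trans pq _.
(* Young's inequality splits both products into squares. *)
have := sqr_ge0 (`|q| - `|y g|).
have : 0 <= Lf * (`|x g - a0| - `|y g|) ^+ 2 by rewrite mulr_ge0// sqr_ge0.
have := sqr_ge0 `|q|; have := sqr_ge0 `|y g|.
have : 0 <= Lf * `|x g - a0| ^+ 2 by rewrite mulr_ge0// sqr_ge0.
have : 0 <= Lf * `|y g| ^+ 2 by rewrite mulr_ge0// sqr_ge0.
rewrite !sqrrB; lra.
Qed.

Lemma edge_integrable_dedge x y : L2 mu x -> L2 mu y -> edge_integrable mu (dedge x y).
Proof.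
move=> Lx Ly; have [iy _] := L2_edge_integrable Ly.
have [ix1 ix2] := L2_edge_integrable (L2B Lx (L2_cst a0)).
have mD := measurable_dedge Lx Ly.
split => //.
(* Young's inequality charges [|y|] squared with at most [Lh] for each Lipschitz term and 1 for the
   gradient at [a0]. *)
pose B c := Lh * (`|x (pr1 c) - a0| ^+ 2 + `|x (pr2 c) - a0| ^+ 2) +
  (1 + 2 * Lh) * `|y (pr1 c)| ^+ 2.
have iB : edge_integrable mu B.
  apply: edge_integrable_add; apply: edge_integrable_scale => //.
  exact: edge_integrable_add.
apply: (integrable_dominated _ _ dh_a0 (edge_integrable_sum iB)).
- by apply: measurable_edge_sum; exact: measurableT_comp.
- by move=> g; apply: edge_sum_ge0 => v _; exact: sqr_ge0.
apply: ae_sub edge_ok => g eg; rewrite ger0_norm ?edge_sum_ge0// -edge_sumD.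
apply: ler_edge_sum => v /eg; set c := cls2 _ _ => rc; rewrite dedgeE//.
apply: le_trans (cauchy_schwarz dot_norm _ _) _.
have [_ _ _ _ /(_ (x (pr1 c)) a0 (x (pr2 c)) a0) L] := rc.
rewrite /B; set p := grad1 _ _ _ _ _ in L *; set q := grad1 _ _ _ _ _ in L *.
set r := `|x _ - _| in L *; set s := `|x _ - _| in L *; set w := y _.
have pq : `|p| <= Lh * (r + s) + `|q|.
  by rewrite -lerBlDr; apply: le_trans (lerB_dist _ _) L.
have {}pq : `|p| * `|w| <= (Lh * (r + s) + `|q|) * `|w| by rewrite ler_wpM2r.
apply: le_trans pq _.
have := sqr_ge0 (`|q| - `|w|).
have : 0 <= Lh * (r - `|w|) ^+ 2 by rewrite mulr_ge0// sqr_ge0.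
have : 0 <= Lh * (s - `|w|) ^+ 2 by rewrite mulr_ge0// sqr_ge0.
have := sqr_ge0 `|q|; have := sqr_ge0 `|w|.
have : 0 <= Lh * r ^+ 2 by rewrite mulr_ge0// sqr_ge0.
have : 0 <= Lh * s ^+ 2 by rewrite mulr_ge0// sqr_ge0.
have : 0 <= Lh * `|w| ^+ 2 by rewrite mulr_ge0// sqr_ge0.
rewrite !sqrrB; lra.
Qed.

Definition energy x g : R := f g (x g) + 2^-1 * \sum_(v \in nbr (root_of g))
  psi (cls2 (root_of g) v) (x g) (x (cls1 v)).

Lemma energyE x g : energy x g =
  f g (x g) + 2^-1 * edge_sum (fun c => psi c (x (pr1 c)) (x (pr2 c))) g.
Proof.
congr (_ + _ * _); apply: eq_fsbigr => v _.
by rewrite pr1_cls2 pr2_cls2 cls1_root_of_of.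
Qed.

Lemma dot_first_order x w g : dot (first_order dot f h x g) w =
  dot (gradient dot (f g) (x g)) w +
  edge_sum (fun c => dot (grad1 dot h c (x (pr1 c)) (x (pr2 c))) w) g.
Proof.
rewrite /first_order dotDl fsbig_finite; last exact: nbr_finite.
rewrite dot_suml edge_sumE; congr (_ + _); apply: eq_bigr => v _.
by rewrite pr1_cls2 pr2_cls2 cls1_root_of_of.
Qed.

(* The symmetrization in [slope] is the one produced by differentiating the
   potential; unimodularity undoes it after integration. *)
Definition slope x y g : R := dvertex x y g +
  2^-1 * (edge_sum (dedge x y) g + edge_sum (dedge x y \o swap) g).

(** For square integrable [x] and [y] this is a measurable version of the integrand of
    [<F(x), y>]. *)
Definition gain x y g : R := dvertex x y g + edge_sum (dedge x y) g.

Definition curvature y g : R := Lf * `|y g| ^+ 2 + 2^-1 *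
  edge_sum (fun c => 2 * Lh * (`|y (pr1 c)| ^+ 2 + `|y (pr2 c)| ^+ 2)) g.

Lemma gainE x y : {ae mu, forall g, gain x y g = dot (first_order dot f h x g) (y g)}.
Proof.
apply: ae_sub (ae_and vertex_ok edge_ok) => g [vg eg].
rewrite dot_first_order /gain dvertexE//; congr (_ + _); apply: eq_edge_sum => v ov.
by rewrite dedgeE ?pr1_cls2 ?cls1_root_of_of//; exact: eg.
Qed.

Lemma integrable_gain x y : L2 mu x -> L2 mu y -> integrable1 (gain x y).
Proof.
move=> Lx Ly; apply: integrable_add; first exact: integrable_dvertex.
by apply: edge_integrable_sum; exact: edge_integrable_dedge.
Qed.

Lemma integrable_slope x y : L2 mu x -> L2 mu y -> integrable1 (slope x y).
Proof.
move=> Lx Ly; apply: integrable_add; first exact: integrable_dvertex.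
have I1 := edge_integrable_dedge Lx Ly.
have I2 := edge_integrable_swap mu_unimodular I1.
by apply: integrable_scale; apply: integrable_add; exact: edge_integrable_sum.
Qed.

Lemma Rintegral_slope x y : L2 mu x -> L2 mu y ->
  \int[mu]_g slope x y g = \int[mu]_g gain x y g.
Proof.
move=> Lx Ly.
have I0 := integrable_dvertex Lx Ly.
have I1 := edge_integrable_dedge Lx Ly.
have I2 := edge_integrable_swap mu_unimodular I1.
have S1 := edge_integrable_sum I1; have S2 := edge_integrable_sum I2.
rewrite RintegralD//; last by apply: integrable_scale; exact: integrable_add.
rewrite RintegralZl//; last exact: integrable_add.
rewrite RintegralD// -(Rintegral_edge_sum_swap mu_unimodular I1) RintegralD//; lra.
Qed.

Lemma integrable_curvature y : L2 mu y -> integrable1 (curvature y).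
Proof.
move=> Ly; have /L2P[_ iy] := Ly; have [i1 i2] := L2_edge_integrable Ly.
apply: integrable_add; apply: integrable_scale => //.
by apply: edge_integrable_sum; apply: edge_integrable_scale; exact: edge_integrable_add.
Qed.

Lemma curvature_ge0 y g : 0 <= curvature y g.
Proof.
rewrite addr_ge0 ?mulr_ge0 ?sqr_ge0 ?invr_ge0// edge_sum_ge0// => v _.
by rewrite mulr_ge0 ?mulr_ge0 ?addr_ge0 ?sqr_ge0.
Qed.

Lemma energy_remainder x y t : 0 <= t <= 1 -> {ae mu, forall g,
  `|energy (fun g => x g + t *: y g) g - energy x g - t * slope x y g|
  <= curvature y g * t ^+ 2}.
Proof.
move=> t01; apply: ae_sub (ae_and vertex_ok (ae_and edge_ok edge_ok')) => g [vg [eg eg']].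
rewrite !energyE /slope.
have -> (a b s s' w u1 u2 : R) :
  a + 2^-1 * s - (b + 2^-1 * s') - t * (w + 2^-1 * (u1 + u2)) =
  (a - b - t * w) + 2^-1 * (s - s' - t * (u1 + u2)) by lra.
rewrite /curvature mulrDl; apply: le_trans (ler_normD _ _) _; apply: lerD.
  by rewrite dvertexE//; case: vg => df Lipf; exact: quadratic_remainder.
rewrite normrM ger0_norm ?invr_ge0// -mulrA ler_wpM2l ?invr_ge0//.
rewrite -!edge_sumB -edge_sumD -edge_sumZ -edge_sumB mulrC -edge_sumZ.
apply: le_trans (ler_norm_edge_sum _ _) _; apply: ler_edge_sum => v ov.
have rc := eg v ov; have rs := eg' v ov.
rewrite /= dedgeE// dedgeE// pr1_swap pr2_swap [leRHS]mulrC.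
exact: psi_remainder.
Qed.

Lemma measurable_energy x : L2 mu x -> measurable_fun setT (energy x : Gspace R 1 -> R).
Proof.
move=> [mx _].
have mx1 := measurableT_comp mx (@measurable_pr1 R).
have mx2 := measurableT_comp mx (@measurable_pr2 R).
have me := measurable_edge_sum (measurable_comp_edge mpsi mx1 mx2).
have mfx := measurable_comp_f mx.
have := measurable_funD mfx (measurable_funM (measurable_cst (2^-1 : R)) me).
by congr (measurable_fun _ _); apply/funext => g; rewrite energyE.
Qed.

(** The energy of the constant profile [a0] is integrable by assumption; the remainder estimate with
    [t = 1] in the direction [x - a0] carries this over to [x]. *)
Lemma integrable_energy x : L2 mu x -> integrable1 (energy x).
Proof.
move=> Lx.
have L0 := L2_cst a0; have Ly := L2B Lx L0; set y := (fun g => _) in Ly.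
have i0 : integrable1 (energy (cst a0)).
  have mp : measurable_fun setT ((fun c => psi c a0 a0) : Gspace R 2 -> R).
    by apply: (measurable_comp_edge mpsi); exact: measurable_cst.
  have mf0 : measurable_fun setT ((fun g => f g a0) : Gspace R 1 -> R).
    by apply: (measurable_comp_f (x := cst a0)); exact: measurable_cst.
  have ip : edge_integrable mu (fun c => psi c a0 a0).
    split => //; apply/integrableP; split.
      by apply/measurable_EFinP; apply: measurable_edge_sum; exact: measurableT_comp.
    apply: le_lt_trans psi_a0; rewrite le_eqVlt; apply/orP; left; apply/eqP.
    by apply: eq_integral => g _; rewrite /= ger0_norm ?edge_sum_ge0.
  have if0 : integrable1 (fun g => f g a0).
    by apply/integrableP; split; first exact/measurable_EFinP.
  have := integrable_add if0 (integrable_scale (2^-1) (edge_integrable_sum ip)).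
  by congr (integrable1 _); apply/funext => g; rewrite energyE.
apply: (integrable_le (measurable_energy Lx)
  (integrable_add (integrable_add (integrable_norm i0) (integrable_norm (integrable_slope L0 Ly)))
    (integrable_curvature Ly))).
have t01 : 0 <= (1 : R) <= 1 by rewrite ler01 lexx.
apply: ae_sub (energy_remainder (cst a0) y t01) => g.
rewrite (_ : (fun g => _) = x); last first.
  by apply/funext => g'; rewrite scale1r /y /= addrC subrK.
rewrite expr1n mulr1 mul1r => E.
have -> : energy x g = energy (cst a0) g + slope (cst a0) y g +
   (energy x g - energy (cst a0) g - slope (cst a0) y g) by lra.
by apply: le_trans (ler_normD _ _) _; apply: lerD => //; exact: ler_normD.
Qed.

Lemma Phi_remainder x y t : L2 mu x -> L2 mu y -> 0 <= t <= 1 ->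
  `|Phi mu f psi (fun g => x g + t *: y g) - Phi mu f psi x
    - t * L2_dot dot mu (first_order dot f h x) y|
  <= (\int[mu]_g curvature y g) * t ^+ 2.
Proof.
move=> Lx Ly t01.
have ix := integrable_energy Lx.
have ixy := integrable_energy (L2_axpy t Lx Ly).
have is_ := integrable_slope Lx Ly.
(* From here on every integrand is measurable and integrable, so linearity of the integral
   applies. *)
have -> : L2_dot dot mu (first_order dot f h x) y = \int[mu]_g slope x y g.
  by rewrite Rintegral_slope//; apply/esym; apply: Rintegral_ae_eq; exact: gainE.
have ic := integrable_scale (t ^+ 2) (integrable_curvature Ly).
rewrite /Phi -/(energy _ _).
rewrite -RintegralZl// -RintegralB// -RintegralB//; last 2 first.
- exact: (integrableB measurableT ixy ix).
- exact: integrable_scale.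
have ir := integrableB measurableT (integrableB measurableT ixy ix) (integrable_scale t is_).
rewrite [leRHS]mulrC -RintegralZl//; last exact: integrable_curvature.
apply: le_trans (le_normr_Rintegral measurableT ir) _.
rewrite -subr_ge0 -RintegralB//; last exact: (integrable_norm ir).
apply: Rintegral_ae_ge0; apply: ae_sub (energy_remainder x y t01) => g.
by rewrite subr_ge0 [t ^+ 2 * _]mulrC.
Qed.

Lemma Phi_tangent x y : L2 mu x -> L2 mu y ->
  tangent (fun t => Phi mu f psi (fun g => x g + t *: y g))
          (L2_dot dot mu (first_order dot f h x) y).
Proof.
move=> Lx Ly; apply: (@tangent_quadratic _ _ _ (\int[mu]_g curvature y g)).
  by apply: Rintegral_ge0 => g _; exact: curvature_ge0.
move=> t t01; have := Phi_remainder Lx Ly t01.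
by under [in X in _ - X - _]eq_fun do rewrite scale0r addr0.
Qed.

(** * The cost of the root player *)

Definition root_cost x g (a : H) : R :=
  f g a + \sum_(v \in nbr (root_of g)) h (cls2 (root_of g) v) a (x (cls1 v)).

Lemma cost_profile x g : cost f h (root_of g) (@profile R H x (graph_of g)) =
  root_cost x g (x g).
Proof. by rewrite /cost /profile cls1_root_of_of. Qed.

Lemma cost_deviation x g a :
  cost f h (root_of g) [eta @profile R H x (graph_of g) with root_of g |-> a] =
  root_cost x g a.
Proof.
rewrite /cost /root_cost /= eqxx cls1_root_of_of; congr (_ + _).
apply: eq_fsbigr => v /set_mem ov; rewrite /profile.
(* There are no loops, so the deviation of the root leaves its neighbours' actions unchanged. *)
by case: eqP => // vo; move: ov; rewrite vo /nbr /= adj_irr.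
Qed.

(** Only the root action varies, so differentiating the finite sum gives [<F(x), w>] directly,
    without symmetrization. *)
Lemma root_cost_tangent x g (w : H) : regular_vertex g ->
  (forall v, nbr (root_of g) v -> regular_edge (cls2 (root_of g) v)) ->
  tangent (fun t => root_cost x g (x g + t *: w)) (dot (first_order dot f h x g) w).
Proof.
move=> [df _] eg; apply: tangent_derive.
rewrite dot_first_order edge_sumE.
rewrite (_ : (fun t => _) = fun t => f g (x g + t *: w) +
   \sum_(v <- fset_set (nbr (root_of g)))
      h (cls2 (root_of g) v) (x g + t *: w) (x (cls1 v))); last first.
  by apply/funext => t; rewrite /root_cost fsbig_finite//; exact: nbr_finite.
have line (F : H -> R) p : is_gradient dot F (x g) p ->
    is_derive (0 : R) 1 (fun t => F (x g + t *: w)) (dot p w).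
  by move=> Fp; apply: is_derive_line; rewrite scale0r addr0.
apply: is_deriveD; first by apply: line; exact: gradientP.
have : forall v, v \in enum_fset (fset_set (nbr (root_of g))) ->
    regular_edge (cls2 (root_of g) v).
  by move=> v; rewrite nbr_fset; exact: eg.
elim: (enum_fset _) => [_|v s IH sr].
  rewrite big_nil (_ : (fun t => _) = cst 0); first exact: is_derive_cst.
  by apply/funext => t; rewrite big_nil.
rewrite big_cons (_ : (fun t => _) = fun t =>
    h (cls2 (root_of g) v) (x g + t *: w) (x (cls1 v)) +
    \sum_(u <- s) h (cls2 (root_of g) u) (x g + t *: w) (x (cls1 u))); last first.
  by apply/funext => t; rewrite big_cons.
apply: is_deriveD; last by apply: IH => u us; apply: sr; rewrite in_cons us orbT.
have [dh _ _ _ _] := sr v (mem_head _ _).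
rewrite pr1_cls2 pr2_cls2 cls1_root_of_of.
by apply: (line (h (cls2 (root_of g) v) ^~ (x (cls1 v)))); exact: gradientP.
Qed.

End potential.

(** * Convexity and the theorem *)

Section convexity.
Variables (R : realType) (V : lmodType R).

(** [conv] puts the weight [t] on its first argument, hence [q] before [p]. *)
Lemma segment_conv (p q : V) (t : R) (t0 : 0 <= t) (t1 : t <= 1) :
  p + t *: (q - p) = @conv R (convex_lmodType V) (Itv01 t0 t1) q p.
Proof.
change (p + t *: (q - p) = t *: q + (1 - t) *: p).
by rewrite scalerBr scalerBl scale1r addrCA addrA.
Qed.

Lemma convex_set_segment (A : set V) p q (t : R) : convex_set A -> A p -> A q ->
  0 <= t <= 1 -> A (p + t *: (q - p)).
Proof.
move=> cA Ap Aq /andP[t0 t1]; rewrite (segment_conv p q t0 t1).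
by apply/set_mem; apply: cA; exact/mem_set.
Qed.

Lemma convex_function_segment (A : set V) (F : V -> R) p q (t : R) :
  convex_function A F -> A p -> A q -> 0 <= t <= 1 ->
  F (p + t *: (q - p)) <= (1 - t) * F p + t * F q.
Proof.
move=> cF Ap Aq /andP[t0 t1]; rewrite (segment_conv p q t0 t1).
apply: le_trans (cF (Itv01 t0 t1) q p (mem_set Aq) (mem_set Ap)) _.
by rewrite le_eqVlt; apply/orP; left; apply/eqP; rewrite convRE/= addrC.
Qed.

End convexity.

(** The dense set of [H] may miss [K], so a point of [K] is picked in each ball of rational type
    [B (s, n)] that meets [K]; indices attached to no such ball get the default [a0]. *)
Lemma countably_dense (R : realType) (H : normedModType R) (K : set H) :
  separable H -> K !=set0 -> exists k : nat -> H, (forall i, K (k i)) /\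
    forall a, K a -> forall e : R, 0 < e -> exists i, `|a - k i| < e.
Proof.
move=> [S cS dS] [a0 Ka0].
have cC : countable (S `*` [set: nat]) by apply: countableX => //; exact: countableP.
have /countable_injP[F Finj] := cC.
pose B (c : H * nat) := ball c.1 (c.2.+1%:R^-1 : R).
have /choice[k kP] : forall i, exists b, K b /\ forall c, (S `*` [set: nat]) c ->
    F c = i -> K `&` B c !=set0 -> B c b.
  move=> i.
  have [[c [Sc ci [b [Kb Bb]]]]|nc] :=
    pselect (exists c, [/\ (S `*` [set: nat]) c, F c = i & K `&` B c !=set0]).
    exists b; split => // c' Sc' c'i _.
    by rewrite (Finj c' c) ?inE// c'i ci.
  exists a0; split => // c Sc ci Kc; exfalso; apply: nc; by exists c.
exists k; split => [i|a Ka e e0]; first exact: (kP i).1.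
have [n ne] : exists n, (n.+1%:R^-1 : R) < e / 2.
  have /cvgrPdist_lt/(_ (e / 2)) := @cvg_harmonic R.
  rewrite divr_gt0// => /(_ isT)[n _ /(_ n (leqnn n))]/=.
  by rewrite sub0r normrN gtr0_norm ?invr_gt0//; exists n.
have [] := dS (ball a (n.+1%:R^-1 : R)) _ (ball_open _ _).
  by exists a; apply: ballxx; rewrite invr_gt0.
move=> s [as_ Ss]; exists (F (s, n)).
have Bk : B (s, n) (k (F (s, n))).
  apply: (kP _).2 => //; exists a; split => //; exact: ball_sym.
have := ball_triangle as_ Bk; rewrite -ball_normE /ball_ /= => /lt_le_trans; apply.
by rewrite [e]splitr lerD// ltW.
Qed.

Theorem theorem3p5 (R : realType)
    (H : completeNormedModType R) (dot : {dot H for idfun})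
    (dot_norm : forall a : H, dot a a = `|a| ^+ 2)
    (H_separable : separable H)
    (K : set H) (K_nonempty : K !=set0) (K_closed : closed K)
    (K_convex : convex_set K)
    (mu : probability (Gspace R 1) R)
    (mu_unimodular : unimodular mu) (mu_bounded : bounded_degree mu)
    (f : isoclass 1 -> H -> R) (h psi : isoclass 2 -> H -> H -> R)
    (fhpsi_admissible : admissible dot mu f h psi)
    (cost_convex : {ae mu, forall g, forall b : graph_of g -> H,
       convex_function [set: H] (fun a : H =>
         f g a + \sum_(v \in nbr (root_of g)) h (cls2 (root_of g) v) a (b v))})
    (x : isoclass 1 -> H) (x_in : L2_in mu K x) :
  let minimizer := forall z, L2_in mu K z -> Phi mu f psi x <= Phi mu f psi z in
  let variational := forall z, L2_in mu K z ->
    0 <= L2_dot dot mu (first_order dot f h x) (z - x) in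
  let nash := quenched_nash mu f h K x in
  [/\ minimizer -> variational,
      variational <-> nash &
      convex_function (L2_in mu K) (Phi mu f psi) -> variational -> minimizer].
Proof.
move=> minimizer variational nash.
case: fhpsi_admissible => mf mh mpsi df dh [Lf [Lh [Lf0 Lh0 lip]]] [a0 [f0 df0 psi0 dh0]].
have vertex_ok : {ae mu, forall g, regular_vertex dot f Lf g}.
  by apply: ae_sub (ae_and df lip) => g [dfg [lipf _]]; split.
have edge_ok : edge_ae mu (regular_edge dot h psi Lh).
  apply: ae_sub (ae_and dh lip) => g [dhg [_ liph]] v ov.
  have [d1 d2 d3 d4] := dhg v ov; split => //; first by rewrite swap_cls2.
  by move=> a a' b b'; exact: liph.
have Phi_tan y z := Phi_tangent dot_norm H_separable mu_unimodular mu_bounded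
  mf mh mpsi Lf0 Lh0 vertex_ok edge_ok f0 df0 psi0 dh0 (x := y) (y := z).
have gain_int y := integrable_gain dot_norm H_separable mu_unimodular mu_bounded
  mf mh Lf0 Lh0 vertex_ok edge_ok df0 dh0 (x := x) (y := y).
have [Lx Kx] := x_in.
have LB z : L2_in mu K z -> L2 mu (z - x).
  by move=> [Lz _]; exact: (L2B dot_norm H_separable Lz Lx).
have cost_tan : {ae mu, forall g, forall w : H,
    tangent (fun t => root_cost f h x g (x g + t *: w)) (dot (first_order dot f h x g) w)}.
  apply: ae_sub (ae_and vertex_ok edge_ok) => g [vg eg] w.
  exact: (root_cost_tangent x w vg eg).
have segment_in z t : L2_in mu K z -> 0 <= t <= 1 ->
    L2_in mu K (fun g => x g + t *: (z - x) g).
  move=> zK t01; split; first by apply: (L2_axpy dot_norm H_separable) => //; exact: LB.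
  apply: ae_sub (ae_and Kx zK.2) => g [Kxg Kzg].
  exact: convex_set_segment.
have ends z : (fun g => x g + 0 *: (z - x) g) = x /\ (fun g => x g + 1 *: (z - x) g) = z.
  split; apply/funext => g; first by rewrite scale0r addr0.
  by rewrite scale1r addrC; exact: subrK.
split.
(* (i) to (ii): the segment from [x] to [z] stays admissible, and the potential along it is smallest
   at [t = 0]. *)
- move=> xmin z zK; apply: tangent_ge0 (Phi_tan _ _ Lx (LB _ zK)) _ => t /andP[t0 t1].
  have t01 : 0 <= t <= 1 by rewrite (ltW t0).
  by rewrite (ends z).1; apply: xmin; exact: segment_in.
- split=> [xvar|xnash z zK]; last first.
    (* (iii) to (ii): the same argument is applied to the root cost of almost every graph, then
       integrated. *)
    apply: Rintegral_ae_ge0.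
    apply: ae_sub (ae_and xnash (ae_and cost_tan (ae_and Kx zK.2))) => g [ng [tg [Kxg Kzg]]].
    apply: tangent_ge0 (tg _) _ => t /andP[t0 t1].
    rewrite scale0r addr0 -cost_profile -cost_deviation; apply: ng.
    have t01 : 0 <= t <= 1 by rewrite (ltW t0).
    exact: convex_set_segment.
  have [k [kK kdense]] := countably_dense H_separable K_nonempty.
  have pointwise i : {ae mu, forall g, 0 <= dot (first_order dot f h x g) (k i - x g)}.
    have Lk : L2 mu (fun g => k i - x g).
      by apply: (L2B dot_norm H_separable) => //; exact: L2_cst.
    set u := gain f h x (fun g => k i - x g).
    have iu : mu.-integrable setT (EFin \o u) by exact: gain_int.
    have mu_ : measurable_fun setT (u : Gspace R 1 -> R).
      by apply/measurable_EFinP; exact: measurable_int iu.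
    have uE : {ae mu, forall g, u g = dot (first_order dot f h x g) (k i - x g)}.
      exact: gainE vertex_ok edge_ok _ _.
    (* Deviating only where [u] is negative makes [<F(x), z - x>] equal to the minimum of [u] and 0
       almost everywhere. *)
    pose z g := if u g < 0 then k i else x g.
    have Lz : L2 mu z.
      have /(L2P)[mx ix] := Lx; have /L2P[_ ik] := L2_cst mu (k i).
      have mz : measurable_fun setT (z : Gspace R 1 -> borel H).
        apply: measurable_fun_ifT => //.
        by apply: measurable_fun_ltr => //; exact: measurable_cst.
      apply/L2P; split => //; apply: (integrable_le _ (integrable_add ix ik)).
        by apply: measurable_funX; exact: measurable_normH.
      apply: aeW => g; rewrite ger0_norm ?sqr_ge0// /z.
      by case: ifP => _; rewrite ?lerDl ?lerDr sqr_ge0.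
    have zK : L2_in mu K z.
      by split => //; apply: ae_sub Kx => g Kxg; rewrite /z; case: ifP.
    pose m g := Num.min (u g) 0.
    have im : mu.-integrable setT (EFin \o m).
      apply: (integrable_le _ (integrable_norm iu)); first exact: measurable_minr.
      apply: aeW => g; rewrite /m; case: (leP (u g) 0) => // _.
      by rewrite normr0 normr_ge0.
    have m_le0 g : m g <= 0 by rewrite ge_min lexx orbT.
    have int_m : 0 <= \int[mu]_g m g.
      have := xvar z zK; rewrite /L2_dot.
      rewrite (@Rintegral_ae_eq _ _ _ mu _ m)//; apply: ae_sub uE => g uE.
      have -> : (z - x) g = (if u g < 0 then k i else x g) - x g by [].
      rewrite /m; case: ltP => ug; first exact/esym.
      by rewrite subrr (dotC dot) dot0l.
    (* A nonpositive function with nonnegative integral vanishes almost everywhere. *)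
    have : (\int[mu]_g `|(m g)%:E| = 0)%E.
      apply/eqP; rewrite eq_le integral_ge0// andbT.
      have iN := integrable_scale (-1) im.
      have -> : (\int[mu]_g `|(m g)%:E| = \int[mu]_g ((-1) * m g)%:E)%E.
        by apply: eq_integral => g _; rewrite mulN1r /= ler0_norm.
      rewrite -(fineK (integrable_fin_num measurableT iN)) lee_fin.
      have := RintegralZl (-1) measurableT im; rewrite /Rintegral => ->.
      by rewrite mulN1r oppr_le0.
    move/(ae_eq_integral_abs mu measurableT (measurable_int _ im)).
    move=> m0; apply: ae_sub (ae_and m0 uE) => g [/(_ I)/= -[mg] <-].
    rewrite leNgt; apply/negP => ug; move: mg; rewrite /m min_l ?ltW// => ug0.
    by move: ug; rewrite ug0 ltxx.
  (* The points [k i] are countably many, so one null set serves them all. *)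
  apply: ae_sub (ae_and (ae_foralln pointwise) (ae_and cost_tan cost_convex)).
  move=> g [pg [tg cg]] a Ka /=; rewrite cost_profile cost_deviation.
  set F := first_order dot f h x g in pg tg.
  have Fa : 0 <= dot F (a - x g).
    rewrite leNgt; apply/negP => Fneg.
    (* At this distance, Cauchy-Schwarz keeps [<F, k i - x g>] negative, a contradiction; adding 1
       covers [F = 0]. *)
    have [|i ai] := kdense a Ka (- dot F (a - x g) / (`|F| + 1)).
      by rewrite divr_gt0 ?oppr_gt0// ltr_wpDl.
    rewrite ltr_pdivlMr ?ltr_wpDl// in ai.
    have := pg i.
    rewrite (_ : k i - x g = (k i - a) + (a - x g)); last by rewrite addrA subrK.
    rewrite (dotDr dot); have := dot_le dot_norm F (k i - a).
    rewrite distrC in ai; have := normr_ge0 (k i - a); nra.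
  have := tangent_convex (tg (a - x g)) Fa.
  rewrite scale0r addr0 scale1r [x g + _]addrC subrK; apply=> t /andP[t0 t1].
  have t01 : 0 <= t <= 1 by rewrite (ltW t0).
  have := convex_function_segment (cg (fun v => x (cls1 v))) (p := x g) (q := a) I I t01.
  by rewrite -/(root_cost _ _ _ _ _).
(* (ii) to (i): convexity along the segment turns the nonnegative slope at [x] into a global
   comparison. *)
- move=> Phic xvar z zK.
  have := tangent_convex (Phi_tan _ _ Lx (LB _ zK)) (xvar z zK).
  rewrite (ends z).1 (ends z).2; apply=> t /andP[t0 t1].
  have t01 : 0 <= t <= 1 by rewrite (ltW t0).
  exact: (convex_function_segment Phic x_in zK t01).
Qed.
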